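(* Let $h\ge 1$, $n\ge 3$ and $d_i\ge 3$ for $0\le i\le h-1$ be any integers, let $z\in\{1,2\}$, and let $T^z=T^z_{d_0,d_1,\ldots,d_{h-1}}$ be the level-wise regular tree with $z$ roots. Then, if $z=1$, $$\mathrm{rn}(T^1\Box K_n)=\left[\left(\sum_{i=1}^{h-1}(2h-2i-1)\left(\prod_{1\le j\le i}(d_j-1)\right)\right)+2h-1\right]nd_0+(2h+1)(n-1),$$ and, if $z=2$, $$\mathrm{rn}(T^2\Box K_n)=\left[\left(\sum_{i=0}^{h-1}(2h-2i-1)\left(\prod_{0\le j\le i}(d_j-1)\right)\right)+2h+1\right]2n-2h-1.$$
   Context: $d_G(u,v)$ denotes the graph distance and $\mathrm{diam}(G)$ the diameter of a connected graph $G$. A radio labelling of $G$ is a mapping $f:V(G)\to\{0,1,2,\ldots\}$ such that $|f(u)-f(v)| \geq \mathrm{diam}(G)+1-d_G(u,v)$ for every pair of distinct vertices $u,v$ of $G$. Its span is $\max\{|f(u)-f(v)| : u,v\in V(G)\}$, and the radio number $\mathrm{rn}(G)$ is the minimum span over all radio labellings of $G$. $K_n$ is the complete graph on $n$ vertices. The Cartesian product $G\Box H$ has vertex set $V(G)\times V(H)$, with $(a,b)$ adjacent to $(c,e)$ if either $a=c$ and $be\in E(H)$, or $b=e$ and $ac\in E(G)$. The center of a tree consists of one vertex $r$ or of two adjacent vertices $r,r'$, according to whether the diameter is even or odd; the tree is viewed as rooted at $r$, respectively at both $r$ and $r'$. A level-wise regular tree is a tree in which all vertices at distance $i$ from the root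 $r$ (respectively from the root set $\{r,r'\}$) have the same degree $d_i$ for $0\le i\le h$, where the height $h$ is the largest distance from a vertex to the root (set); vertices at distance $h$ are leaves. Such a tree is determined by its number $z\in\{1,2\}$ of roots and by $(d_0,d_1,\ldots,d_{h-1})$, and is denoted $T^z_{d_0,d_1,\ldots,d_{h-1}}$. (Degrees count all neighbours; so for $z=2$ each of $r,r'$ has degree $d_0$, including the edge $rr'$.) *)

(* Defs.v *)
From mathcomp Require Import all_boot ssrint.
From mathcomp Require Import boolp.

Set Implicit Arguments.
Unset Strict Implicit.
Unset Printing Implicit Defensive.

Record sgraph := SGraph {
  vertex :> finType;
  edge : rel vertex;
  edge_sym : symmetric edge;
  edge_irr : irreflexive edge }.

Section GraphMetric.
Variable G : sgraph.
Implicit Types (u v : G) (A : {set G}).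

Definition has_walk (k : nat) u v : bool :=
  [exists p : k.-tuple G, path (@edge G) u p && (last u p == v)].

(* A shortest path has fewer than #|G| edges, so in a connected graph the
   search always succeeds; #|G| is a junk value for unreachable pairs. *)
Definition dist u v : nat := find (fun k => has_walk k u v) (iota 0 #|G|).

(* The least value of dist a v for a in A, with the same junk value. *)
Definition dist_set A v : nat :=
  find (fun k => [exists a in A, dist a v == k]) (iota 0 #|G|).

Definition ecc v : nat := \max_(u : G) dist v u.

Definition diam : nat := \max_(v : G) ecc v.

Definition deg v : nat := #|[set u | edge v u]|.

Definition center : {set G} := [set v | [forall u : G, ecc v <= ecc u]].

Definition connected : Prop := forall u v, connect (@edge G) u v.

(* [:: u; v] is a [ucycle] for every edge uv, hence the bound 2. *)
Definition acyclic : Prop :=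
  forall c : seq G, ucycle (@edge G) c -> size c <= 2.

Definition is_tree : Prop := [/\ 0 < #|G|, connected & acyclic].

Definition level v : nat := dist_set center v.

Definition height : nat := \max_(v : G) level v.

(* The subtraction does not truncate when G is connected: dist u v <= diam. *)
Definition radio_labelling (f : G -> nat) : Prop :=
  forall u v, u != v -> diam + 1 - dist u v <= `|f u - f v|%N.

Definition span (f : G -> nat) : nat :=
  \max_(u : G) \max_(v : G) `|f u - f v|%N.

Definition is_radio_span (k : nat) : Prop :=
  exists2 f : G -> nat, radio_labelling f & span f = k.

Lemma ex_radio_span : exists k, `[< is_radio_span k >].
Proof.
pose f (v : G) : nat := enum_rank v * (diam + 1).
exists (span f); apply/asboolP; exists f => // u v uv.
apply: leq_trans (leq_subr _ _) _.
wlog lt_uv : u v uv / enum_rank u < enum_rank v.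
  move=> W; case: (ltngtP (enum_rank u) (enum_rank v)) => [||/ord_inj/enum_rank_inj eq_uv].
  - exact: W.
  - by rewrite distnC; apply: W; rewrite eq_sym.
  - by rewrite eq_uv eqxx in uv.
rewrite distnEr; last by rewrite leq_mul2r (ltnW lt_uv) orbT.
by rewrite -mulnBl leq_pmull // subn_gt0.
Qed.

Definition rn : nat := ex_minn ex_radio_span.

(* The tree T^z_{d_0,...,d_{h-1}}, up to isomorphism; only d 0, ..., d h.-1
   are used. *)
Definition levelwise_regular_tree (z h : nat) (d : nat -> nat) : Prop :=
  [/\ is_tree, #|center| = z, height = h,
      forall v, level v < h -> deg v = d (level v)
    & forall v, level v = h -> deg v = 1].

End GraphMetric.

Section CompleteGraph.
Variable n : nat.

Definition complete_edge : rel 'I_n := fun i j => i != j.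

Lemma complete_edge_sym : symmetric complete_edge.
Proof. by move=> i j; rewrite /complete_edge eq_sym. Qed.

Lemma complete_edge_irr : irreflexive complete_edge.
Proof. by move=> i; rewrite /complete_edge eqxx. Qed.

Definition complete_graph : sgraph :=
  SGraph complete_edge_sym complete_edge_irr.

End CompleteGraph.

Section CartesianProduct.
Variables G H : sgraph.

Definition box_edge : rel (G * H) := fun u v =>
  (u.1 == v.1) && edge u.2 v.2 || (u.2 == v.2) && edge u.1 v.1.

Lemma box_edge_sym : symmetric box_edge.
Proof.
move=> u v; rewrite /box_edge edge_sym [edge u.1 _]edge_sym.
by rewrite (eq_sym u.1) (eq_sym u.2).
Qed.

Lemma box_edge_irr : irreflexive box_edge.
Proof. by move=> u; rewrite /box_edge !edge_irr !andbF. Qed.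

Definition box : sgraph := SGraph box_edge_sym box_edge_irr.

End CartesianProduct.

(* Main.v *)
Require Import Defs.
From mathcomp Require Import all_boot ssrint boolp zify.

(** Write L v for the level of a vertex of the tree and call the second
    coordinate of a vertex of the product its colour. A distance in the product
    is the distance in the tree plus 1 if the colours differ, and it is at most
    L x + L y + z, whereas the diameter is 2h + z. So consecutive labels of a
    radio labelling differ by at least 2h + 1 - L x - L y. Summed along all N
    vertices in the order of their labels, this bounds the span from below by
    (2h + 1)(N - 1) minus twice the sum of all levels (radio_span_lower), and
    counting the vertices level by level turns the bound into the two formulas.

    The bound is attained if the vertices have an order that starts and ends on
    level 0 and for which the labels built from exactly these gaps respect every
    pair (rn_of_order). For x and y separated by the vertices of m the condition
    is admissible x m y: the slack, the sum of 2h + 1 - 2 L v over m, must make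
    up for what the distance of x and y lacks. If l is the level of their deepest
    common ancestor, that distance is at least L x + L y - 2l (dist_lower), so a
    slack of z + 2l is enough, and one unit less if the colours differ. Every
    vertex of m contributes at least 1.

    The levels are therefore listed so that a common ancestor forces a large
    distance in the list: level k + 1 runs through level k once for every child
    number. Then the ancestors on level l recur with the width of level l as
    period, even across the boundaries between levels (common_levels). Since all
    branchings are at least 2, and at least 3 below a single root, that width is
    at least z + 2l, with equality for l <= 1 only; colours that alternate
    (z = 1) or have period 3 (z = 2) supply the last unit (row_admissible).

    Finally n copies of this traversal of the tree, the q-th with all colours
    shifted by q, are put one after the other. A root between two vertices is
    slack enough for any pair (admissible_root), so the copies do not disturb
    each other where a root separates them. If z = 2, each traversal starts at
    one root and ends at the other. If z = 1, there are only n root copies for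
    the n + 1 places before, between and after the traversals, and the last two
    traversals follow each other directly (double_row_admissible). *)

Set Implicit Arguments.
Unset Strict Implicit.
Unset Printing Implicit Defensive.


(** * Walks and distances *)

Section Metric.
Variable G : sgraph.
Implicit Types (u v w : G) (p : seq G).

Lemma has_walkP k u v :
  reflect (exists p, [/\ path (@edge G) u p, last u p = v & size p = k])
          (has_walk k u v).
Proof.
apply: (iffP existsP) => [[p /andP[ep /eqP lp]]|[p [ep lp sp]]].
  by exists p; rewrite size_tuple.
have sp' : size p == k by apply/eqP.
by exists (Tuple sp'); rewrite /= ep lp eqxx.
Qed.

Lemma dist_le_walk u p : path (@edge G) u p -> dist u (last u p) <= size p.
Proof.
move=> ep; rewrite /dist; set a := (fun k => _).
have [lt_p|le_p] := ltnP (size p) #|G|; last first.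
  (* The value of dist never exceeds #|G|, even where it is junk. *)
  by apply: leq_trans (find_size _ _) _; rewrite size_iota.
rewrite leqNgt; apply/negP => /(before_find 0).
rewrite nth_iota // add0n => /negbT/negP; apply.
by rewrite /a; apply/has_walkP; exists p.
Qed.

Lemma dist_le u v p : path (@edge G) u p -> last u p = v -> dist u v <= size p.
Proof. by move=> ep <-; apply: dist_le_walk. Qed.

Lemma dist_vv v : dist v v = 0.
Proof. by have := @dist_le v v [::] isT erefl; rewrite leqn0 => /eqP. Qed.

Hypothesis connG : connected G.

Lemma dist_lt_card u v : dist u v < #|G|.
Proof.
have /connectP[p0 ep0 ->] := connG u v.
case/shortenP: ep0 => p ep up _.
apply: leq_ltn_trans (dist_le_walk ep) _.
by have := card_uniqP up => /= <-; apply: max_card.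
Qed.

Lemma shortest_walk u v :
  exists p, [/\ path (@edge G) u p, last u p = v & size p = dist u v].
Proof.
apply/has_walkP; have := dist_lt_card u v; rewrite /dist; set a := (fun k => _).
rewrite -[X in _ < X](size_iota 0) -has_find => ha.
have := nth_find 0 ha; rewrite nth_iota //.
by rewrite -[X in _ < X](size_iota 0) -has_find.
Qed.

Lemma dist_triangle u v w : dist u w <= dist u v + dist v w.
Proof.
have [p [ep lp <-]] := shortest_walk u v; have [q [eq lq <-]] := shortest_walk v w.
by rewrite -size_cat; apply: dist_le; rewrite ?cat_path ?last_cat lp // ep.
Qed.

Lemma dist_sym u v : dist u v = dist v u.
Proof.
suff le_d (x y : G) : dist x y <= dist y x by apply/eqP; rewrite eqn_leq !le_d.
have [p [ep lp <-]] := shortest_walk y x.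
rewrite -[X in _ <= X](size_belast y) -size_rev.
apply: dist_le; first by rewrite -lp rev_path; apply: sub_path ep => ? ?; rewrite edge_sym.
case: p lp {ep} => [|z p] //= _; by rewrite rev_cons last_rcons.
Qed.

Lemma dist_edge u v : edge u v -> dist u v <= 1.
Proof. by move=> uv; apply: (@dist_le u v [:: v]); rewrite /= ?uv. Qed.

Lemma dist_edge_step w u v : edge u v -> dist w v <= (dist w u).+1.
Proof.
by move=> uv; have := dist_triangle w u v; have := dist_edge uv; lia.
Qed.

Lemma dist_eq0 u v : dist u v = 0 -> u = v.
Proof.
by move=> d0; have [p [_ lp]] := shortest_walk u v; rewrite d0 => /size0nil p0; rewrite -lp p0.
Qed.

Lemma dist_closer w v : 0 < dist w v -> exists2 u, edge v u & (dist w u).+1 = dist w v.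
Proof.
have [p [ep lp sp]] := shortest_walk w v; rewrite -sp => p_gt0.
case/lastP: p p_gt0 ep lp sp => // p v' _.
rewrite rcons_path last_rcons size_rcons => /andP[ep ev] <- sp.
exists (last w p); first by rewrite edge_sym.
apply/eqP; rewrite eqSS eqn_leq dist_le_walk //=.
by have := dist_edge_step w ev; rewrite -sp.
Qed.

Section DistSet.
Variable A : {set G}.
Hypothesis A_neq0 : A != set0.

Lemma dist_set_attained v : exists2 a, a \in A & dist a v = dist_set A v.
Proof.
rewrite /dist_set; pose P k := [exists a in A, dist a v == k]; rewrite -/P.
have [a aA] := set0Pn _ A_neq0.
have hP : has P (iota 0 #|G|).
  apply/hasP; exists (dist a v); first by rewrite mem_iota dist_lt_card.
  by apply/existsP; exists a; rewrite aA eqxx.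
have := nth_find 0 hP; rewrite nth_iota; last by rewrite -[X in _ < X](size_iota 0) -has_find.
by case/existsP => b /andP[bA /eqP]; exists b.
Qed.

Lemma dist_set_le a v : a \in A -> dist_set A v <= dist a v.
Proof.
move=> aA; rewrite leqNgt; apply/negP => /(before_find 0).
rewrite nth_iota ?dist_lt_card // => /negbT/negP; apply.
by apply/existsP; exists a; rewrite aA eqxx.
Qed.

Lemma dist_set_eq0 v : (dist_set A v == 0) = (v \in A).
Proof.
apply/eqP/idP => [|vA]; last by apply/eqP; rewrite -leqn0 -(dist_vv v) dist_set_le.
by have [a aA <- /dist_eq0 <-] := dist_set_attained v.
Qed.

Lemma dist_set_step u v : edge u v -> dist_set A v <= (dist_set A u).+1.
Proof.
move=> uv; have [a aA <-] := dist_set_attained u.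
by apply: leq_trans (dist_set_le _ aA) _; apply: dist_edge_step.
Qed.

Lemma dist_set_closer v :
  0 < dist_set A v -> exists2 u, edge v u & (dist_set A u).+1 = dist_set A v.
Proof.
have [a aA av] := dist_set_attained v; rewrite -av => d_gt0.
have [u vu du] := dist_closer d_gt0; exists u => //.
have uv : edge u v by rewrite edge_sym.
by have := dist_set_step uv; have := dist_set_le u aA; lia.
Qed.

End DistSet.
End Metric.


(** * Unique lower neighbours and the centre of a tree *)

Section Acyclic.
Variable G : sgraph.
Hypothesis acycG : acyclic G.

(** A walk from u1 to u2 that avoids v closes up to a cycle through v. *)
Lemma acyclic_separates (v u1 u2 : G) :
  edge v u1 -> edge v u2 ->
  connect (fun x y => [&& edge x y, x != v & y != v]) u1 u2 -> u1 = u2.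
Proof.
move=> vu1 vu2 /connectP[p0 ep0 lp]; subst u2.
case/shortenP: ep0 vu2 => p ep up _ vl; case: p ep up vl => // w p ep up vl.
have vp : v \notin u1 :: w :: p.
  move: (ep) => /= /andP[/and3P[_ u1v _] _]; rewrite inE negb_or eq_sym u1v /=.
  elim: (w :: p) (u1) ep => //= x q IH y /andP[/and3P[_ _ xv] eq].
  by rewrite inE negb_or eq_sym xv; apply: IH eq.
suff /acycG : ucycle (@edge G) [:: v, u1, w & p] by [].
apply/andP; split; last by rewrite cons_uniq vp.
change (path (@edge G) v (rcons [:: u1, w & p] v)).
rewrite rcons_path [path _ _ _]/= vu1 [X in X && _](_ : _ = true) /=; last first.
  by apply: (sub_path _ ep) => x y /and3P[].
by rewrite edge_sym.
Qed.

(** Vertices of rank at most that of v, other than v itself, descend to the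
    connected bottom while avoiding v; two of them adjacent to v would close a
    cycle through v. *)
Lemma rank_neighbour_unique (rk : G -> nat) (v u1 u2 : G) :
  (forall x, 0 < rk x -> exists2 y, edge x y & (rk y).+1 = rk x) ->
  (forall x y, rk x = 0 -> rk y = 0 -> x = y \/ edge x y) ->
  0 < rk v -> edge v u1 -> edge v u2 -> rk u1 <= rk v -> rk u2 <= rk v ->
  u1 = u2.
Proof.
move=> descend bottom v_gt0 vu1 vu2 r1 r2.
pose e x y := [&& edge x y, x != v & y != v].
have neqv x : edge v x -> x != v by apply: contraTneq => ->; rewrite edge_irr.
have neq0 x : rk x = 0 -> x != v by move=> x0; apply: contraTneq v_gt0 => <-; rewrite x0.
have down k : forall x, rk x = k -> x != v -> rk x <= rk v ->
    exists2 a, rk a = 0 & connect e x a.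
  elim: k => [|k IH] x xk xv x_le; first by exists x.
  have [|y xy ry] := descend x; first by rewrite xk.
  have yv : y != v by apply: contraTneq x_le => yv; rewrite -yv -ry ltnn.
  have [||a a0 ya] := IH y _ yv; [by lia|by lia|].
  exists a => //; apply: connect_trans ya; apply: connect1.
  by rewrite /e xy xv yv.
have [a1 a10 c1] := down _ u1 erefl (neqv _ vu1) r1.
have [a2 a20 c2] := down _ u2 erefl (neqv _ vu2) r2.
have e_sym : connect_sym e.
  apply: sym_connect_sym => x y; rewrite /e edge_sym.
  by case: (edge y x); case: (x != v); case: (y != v).
apply: (acyclic_separates vu1 vu2); rewrite -/e.
apply: connect_trans c1 _; rewrite e_sym in c2; apply: connect_trans c2.
have [->|a12] := bottom a1 a2 a10 a20; first exact: connect0.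
by apply: connect1; rewrite /e a12 !neq0.
Qed.

End Acyclic.

Section Centre.
Variable G : sgraph.
Hypotheses (connG : connected G) (acycG : acyclic G).
Implicit Types (u v w x y : G).

Lemma dist_le_ecc u v : dist u v <= ecc u.
Proof. exact: (@leq_bigmax _ (fun v => dist u v)). Qed.

Lemma ecc_le_diam u : ecc u <= diam G.
Proof. exact: (@leq_bigmax _ (fun v : G => ecc v)). Qed.

Lemma ecc_attained u : exists v, dist u v = ecc u.
Proof.
have [|v ev] := @eq_bigmax _ (dist u); last by exists v; rewrite /ecc ev.
by apply/card_gt0P; exists u.
Qed.

(** Every vertex w lies on at most one side of y, so one of two distinct
    neighbours of y is farther from w than y; take w farthest from y. *)
Lemma ecc_convex x y w :
  edge y x -> edge y w -> x != w -> (ecc y < ecc x) || (ecc y < ecc w).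
Proof.
move=> yx yw; apply: contraR; rewrite negb_or -!leqNgt => /andP[ex ew].
have [t yt] := ecc_attained y.
have tx : dist t x <= dist t y.
  by rewrite dist_sym // (dist_sym connG t) yt; apply: leq_trans ex; apply: dist_le_ecc.
have tw : dist t w <= dist t y.
  by rewrite dist_sym // (dist_sym connG t) yt; apply: leq_trans ew; apply: dist_le_ecc.
have [ty0|ty_gt0] := posnP (dist t y).
  move: tx tw; rewrite ty0 !leqn0 => /eqP/(dist_eq0 connG) <-.
  by move/eqP/(dist_eq0 connG) <-.
apply/eqP; apply: (rank_neighbour_unique acycG (rk := dist t) (v := y)) => //.
- by move=> z; apply: dist_closer.
- by move=> a b /(dist_eq0 connG) <- /(dist_eq0 connG) <-; left.
Qed.

(** By convexity the eccentricity, once it has not dropped in the first step,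
    strictly increases along the rest of the path. *)
Lemma ecc_increases (p : seq G) : forall x y,
  path (@edge G) x (y :: p) -> uniq [:: x, y & p] -> ecc x <= ecc y ->
  ecc y + size p <= ecc (last y p).
Proof.
elim: p => [|z p IH] x y; first by rewrite addn0.
move=> /= /and3P[xy yz ep] /and4P[]. rewrite !in_cons !negb_or.
move=> /and3P[_ xz _] yzp zp up xy_le.
have := @ecc_convex x y z; rewrite edge_sym xy yz xz ltnNge xy_le /= => /(_ isT isT isT) yz_lt.
have := IH y z; rewrite /= yz ep inE negb_or => /(_ isT).
move: yzp zp up => -> -> -> /(_ isT (ltnW yz_lt)).
by lia.
Qed.

(** A path between two vertices of minimal eccentricity cannot be longer than
    one edge, since its eccentricities would increase at its far end. *)
Lemma center_adjacent a b : a \in center G -> b \in center G -> a = b \/ edge a b.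
Proof.
rewrite !inE => /forallP ca /forallP cb.
have /connectP[p0 ep0 lp0] := connG a b; subst b.
case/shortenP: ep0 cb => p ep up _ cb.
case: p ep up cb => [|y p] ep up cb; first by left.
right; have := ecc_increases ep up (ca y); have := cb y; have /= := cb a; have := ca y.
move: ep => /= /andP[ay _].
by case: p {up cb} => [|z p] //=; lia.
Qed.

End Centre.


(** * Rooted trees and the lists of their levels *)

Section Rooted.
Variables (T : sgraph) (x0 : T) (h z : nat) (b : nat -> nat).
Variables (L : T -> nat) (par : T -> T).
Implicit Types (u v x y : T).

Definition children v : {set T} := [set u | (0 < L u) && (par u == v)].

(** The level structure, with parent function par, of a tree that hangs from
    one root or from two adjacent ones: the only edges are those to parents and
    the one between the roots. *)
Record rooted : Prop := Rooted {
  rooted_conn : connected T;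
  rooted_height : forall v, L v <= h;
  rooted_level_par : forall v, 0 < L v -> (L (par v)).+1 = L v;
  rooted_edge_par : forall v, 0 < L v -> edge v (par v);
  rooted_edge_cases : forall u v, edge u v ->
    [\/ 0 < L v /\ u = par v, 0 < L u /\ v = par u | L u = 0 /\ L v = 0];
  rooted_roots : #|[set v | L v == 0]| = z;
  rooted_roots_dist : forall u v, L u = 0 -> L v = 0 -> dist u v <= z - 1;
  rooted_children : forall v, L v < h -> #|children v| = b (L v) }.

Hypothesis rT : rooted.

Definition level_width l : nat := z * \prod_(j < l) b j.

Definition child v j : T := nth v (enum (children v)) j.

(** Siblings are placed a whole width of the level above apart: vertices with a
    deep common ancestor have to be far from each other in the order of the
    labels. *)
Fixpoint level_node l t : T :=
  if l is k.+1 then child (level_node k (t %% level_width k)) (t %/ level_width k)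
  else nth x0 (enum [set v | L v == 0]) t.

Definition anc l v : T := iter (L v - l) par v.

(** The inequalities are needed because anc l v is v itself when L v < l. *)
Definition common l u v : bool := [&& l <= L u, l <= L v & anc l u == anc l v].

Definition level_list a c : seq T := flatten [seq mkseq (level_node l) (level_width l) | l <- iota a c].

Lemma widthS l : level_width l.+1 = level_width l * b l.
Proof. by rewrite /level_width big_ord_recr mulnA. Qed.

Lemma width_dvd l k : l <= k -> level_width l %| level_width k.
Proof.
elim: k => [|k IH]; first by rewrite leqn0 => /eqP->.
rewrite leq_eqVlt => /predU1P[->//|/IH]; rewrite widthS; exact: dvdn_mulr.
Qed.

Lemma child_mem v j : L v < h -> j < b (L v) -> child v j \in children v.
Proof. by move=> vh jb; rewrite -mem_enum mem_nth // -cardE rooted_children. Qed.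

Lemma child_level v j : L v < h -> j < b (L v) -> L (child v j) = (L v).+1.
Proof.
move=> vh /(child_mem vh); rewrite inE => /andP[c0 /eqP pv].
by rewrite -(rooted_level_par rT c0) pv.
Qed.

Lemma child_par v j : L v < h -> j < b (L v) -> par (child v j) = v.
Proof. by move=> vh /(child_mem vh); rewrite inE => /andP[_ /eqP]. Qed.

Lemma node_split l t : t < level_width l.+1 -> t %% level_width l < level_width l /\ t %/ level_width l < b l.
Proof.
rewrite widthS => lt_t.
have w_gt0 : 0 < level_width l by case: (level_width l) lt_t => //; rewrite mul0n.
by rewrite ltn_mod w_gt0 ltn_divLR // mulnC.
Qed.

Lemma node_level l t : l <= h -> t < level_width l -> L (level_node l t) = l.
Proof.
elim: l t => [|l IH] t lh.
  rewrite /level_width big_ord0 muln1 => tz.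
  have : level_node 0 t \in [set v | L v == 0].
    by rewrite -mem_enum mem_nth // -cardE rooted_roots.
  by rewrite inE => /eqP.
move=> /node_split[t1 t2]; have Ll := IH _ (ltnW lh) t1.
by rewrite /= child_level ?Ll.
Qed.

Lemma node_par l t : l < h -> t < level_width l.+1 -> par (level_node l.+1 t) = level_node l (t %% level_width l).
Proof.
move=> lh /node_split[t1 t2]; have Ll := node_level (ltnW lh) t1.
by rewrite /= child_par ?Ll.
Qed.

Lemma node_inj l t t' : l <= h -> t < level_width l -> t' < level_width l ->
  level_node l t = level_node l t' -> t = t'.
Proof.
elim: l t t' => [|l IH] t t' lh.
  rewrite /level_width big_ord0 muln1 => tz t'z /eqP.
  by rewrite nth_uniq ?enum_uniq -?cardE ?rooted_roots // => /eqP.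
move=> tw t'w e; have [t1 t2] := node_split tw; have [t'1 t'2] := node_split t'w.
have em : t %% level_width l = t' %% level_width l.
  by apply: IH => //; [exact: ltnW|rewrite -!node_par // e].
have Ll := node_level (ltnW lh) t1.
move: e; rewrite /= -em => /eqP.
rewrite nth_uniq ?enum_uniq -?cardE ?rooted_children ?Ll // => /eqP ed.
by rewrite (divn_eq t (level_width l)) ed em -divn_eq.
Qed.

Lemma node_onto v : exists2 t, t < level_width (L v) & level_node (L v) t = v.
Proof.
move Ll: (L v) => l; elim: l v Ll => [|l IH] v Ll.
  have vE : v \in enum [set v | L v == 0] by rewrite mem_enum inE Ll.
  exists (index v (enum [set v | L v == 0])); last by rewrite /= nth_index.
  by rewrite /level_width big_ord0 muln1 -(rooted_roots rT) cardE index_mem.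
have v0 : 0 < L v by rewrite Ll.
have Lp : L (par v) = l by have := rooted_level_par rT v0; rewrite Ll => -[].
have lh : l < h by have := rooted_height rT v; rewrite Ll.
have [t tw et] := IH _ Lp.
have vE : v \in enum (children (par v)) by rewrite mem_enum inE v0 eqxx.
pose j := index v (enum (children (par v))).
have jb : j < b l by rewrite -Lp -(rooted_children rT) ?Lp // cardE index_mem.
have w_gt0 : 0 < level_width l by apply: leq_ltn_trans tw.
exists (j * level_width l + t); first by rewrite widthS; nia.
rewrite /= modnMDl modn_small // divnMDl // divn_small // addn0 et.
by rewrite /child nth_index.
Qed.

Lemma anc_self v : anc (L v) v = v.
Proof. by rewrite /anc subnn. Qed.

Lemma anc_par l v : 0 < L v -> l <= L (par v) -> anc l (par v) = anc l v.
Proof.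
move=> v0 lp; rewrite /anc -[in RHS](rooted_level_par rT v0) subSn //.
by rewrite iterSr.
Qed.

Lemma anc_node l k t : l <= k <= h -> t < level_width k -> anc l (level_node k t) = level_node l (t %% level_width l).
Proof.
elim: k t => [|k IH] t /andP[lk kh] tw.
  move: lk; rewrite leqn0 => /eqP->.
  by rewrite modn_small // -{1}(node_level kh tw) anc_self.
have [->|lk'] := eqVneq l k.+1.
  by rewrite modn_small // -{1}(node_level kh tw) anc_self.
have {lk'}lk : l <= k by lia.
have [t1 t2] := node_split tw; have Ll := node_level (ltnW kh) t1.
rewrite -anc_par ?(node_level kh tw) // node_par // ?Ll //.
by rewrite IH ?lk ?(ltnW kh) // modn_dvdm // width_dvd.
Qed.

Lemma anc_par_common l v : 0 < L v -> l < L v -> anc l (par v) = anc l v.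
Proof. by move=> v0 lv; apply: anc_par => //; rewrite -ltnS rooted_level_par. Qed.

(** Induction on the walk: a step along an edge to a parent changes one level
    by one, and it replaces the common ancestor by its parent only if the walk
    leaves the subtree below it. A step between two roots leaves the subtree
    altogether; the walk then is longer than the sum of the level_list. *)
Lemma walk_length u p : path (@edge T) u p ->
  (exists2 l, common l u (last u p) & L u + L (last u p) <= size p + 2 * l)
  \/ L u + L (last u p) < size p.
Proof.
elim: p u => [|w p IH] u /=.
  by move=> _; left; exists (L u); rewrite /common ?leqnn ?eqxx //; lia.
case/andP=> uw /IH; set v := last w p.
have irr : u != w by apply: contraTneq uw => ->; rewrite edge_irr.
case: (rooted_edge_cases rT uw) => [[w0 eu]|[u0 ew]|[Lu Lw]].
- have Lw := rooted_level_par rT w0; rewrite -eu in Lw.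
  case=> [[l /and3P[lw lv /eqP alv] le_l]|]; last by right; lia.
  have [lu|ul] := leqP l (L u).
    left; exists l; last by lia.
    by rewrite /common lu lv -alv -(@anc_par_common l w) -?eu ?eqxx //; lia.
  have el : l = (L u).+1 by lia.
  left; exists (L u); last by lia.
  rewrite /common leqnn anc_self (_ : L u <= L v) /=; last by lia.
  have ev : anc (L u) v = par (anc l v).
    by rewrite /anc (_ : L v - L u = (L v - l).+1) //; lia.
  by rewrite ev -alv {1}el Lw anc_self -eu.
- have Lu := rooted_level_par rT u0; rewrite -ew in Lu.
  case=> [[l /and3P[lw lv /eqP alv] le_l]|]; last by right; lia.
  left; exists l; last by lia.
  rewrite /common lv -alv (_ : l <= L u) /=; last by lia.
  by rewrite ew anc_par_common //; lia.
- case=> [[l /and3P[lw lv /eqP alv] le_l]|]; last by right; lia.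
  by right; lia.
Qed.

Lemma dist_lower u v :
  (exists2 l, common l u v & L u + L v <= dist u v + 2 * l) \/ L u + L v < dist u v.
Proof.
have [p [ep lp <-]] := shortest_walk (rooted_conn rT) u v.
by have := walk_length ep; rewrite lp.
Qed.

Lemma dist_root u : dist u (anc 0 u) <= L u.
Proof.
move Lu: (L u) => k; elim: k u Lu => [|k IH] u Lu.
  by rewrite -{1}Lu anc_self dist_vv.
have u0 : 0 < L u by rewrite Lu.
have Lp : L (par u) = k by have := rooted_level_par rT u0; rewrite Lu => -[].
rewrite -anc_par //.
apply: leq_trans (dist_triangle (rooted_conn rT) _ (par u) _) _.
by rewrite -add1n leq_add ?IH //; apply/dist_edge/rooted_edge_par.
Qed.

Lemma anc0_level u : L (anc 0 u) = 0.
Proof.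
move Lu: (L u) => k; elim: k u Lu => [|k IH] u Lu.
  by rewrite -{1}Lu anc_self.
have u0 : 0 < L u by rewrite Lu.
have Lp : L (par u) = k by have := rooted_level_par rT u0; rewrite Lu => -[].
by rewrite -anc_par // IH.
Qed.

Lemma dist_upper u v : dist u v <= L u + L v + (z - 1).
Proof.
have c := rooted_conn rT.
have := dist_triangle c u (anc 0 u) v; have := dist_triangle c (anc 0 u) (anc 0 v) v.
have := dist_root u; have := dist_root v; rewrite (dist_sym c v).
by have := rooted_roots_dist rT (anc0_level u) (anc0_level v); lia.
Qed.

(** Each level repeats the list of the level above it a whole number of times.
    Hence the ancestors on level l run periodically through the list of that
    level, and the widths dividing each other keeps the phase when one level
    follows another. *)
Lemma anc_levels l a c i : l <= a -> a + c <= h.+1 -> i < size (level_list a c) ->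
  anc l (nth x0 (level_list a c) i) = level_node l (i %% level_width l).
Proof.
elim: c a i => [|c IH] a i la ach //=.
rewrite /level_list /= -/(level_list a.+1 c) size_cat nth_cat size_mkseq.
have [ia _|ai i_lt] := ltnP i (level_width a).
  by rewrite nth_mkseq // anc_node ?la //; lia.
rewrite IH; [|by lia|by lia|by lia].
by rewrite -[in RHS](subnK ai) -modnDmr (eqP (width_dvd la)) addn0.
Qed.

Lemma mem_levels a c v : a + c <= h.+1 -> (v \in level_list a c) = (a <= L v < a + c).
Proof.
elim: c a => [|c IH] a ach; first by rewrite in_nil; lia.
rewrite /level_list /= mem_cat -/(level_list a.+1 c) IH; last by lia.
suff -> : (v \in mkseq (level_node a) (level_width a)) = (L v == a) by lia.
apply/mapP/eqP => [[t]|<-].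
  by rewrite mem_iota => /andP[_ tw] ->; rewrite node_level //; lia.
by have [t tw <-] := node_onto v; exists t; rewrite ?mem_iota // node_level // rooted_height.
Qed.

Lemma uniq_levels a c : a + c <= h.+1 -> uniq (level_list a c).
Proof.
elim: c a => [|c IH] a ach //.
rewrite /level_list /= -/(level_list a.+1 c) cat_uniq IH ?andbT; last by lia.
apply/andP; split.
  by apply/mkseq_uniqP => t t'; rewrite !inE => tw t'w; apply: node_inj => //; lia.
apply/hasPn => v; rewrite mem_levels; last by lia.
move=> /andP[av _]; apply/negP => /mapP[t]; rewrite mem_iota => /andP[_ tw] ev.
by move: av; rewrite ev node_level ?ltnn //; lia.
Qed.

Lemma perm_levels : perm_eq (enum T) (level_list 0 h.+1).
Proof.
apply: uniq_perm; rewrite ?enum_uniq ?uniq_levels // => v.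
by rewrite mem_enum mem_levels //= ltnS rooted_height.
Qed.

Lemma size_levels a c : size (level_list a c) = \sum_(a <= l < a + c) level_width l.
Proof.
rewrite /level_list size_flatten sumnE big_map big_map /index_iota addKn.
by apply: eq_bigr => l _; rewrite size_mkseq.
Qed.

Lemma sum_over_levels (F : nat -> nat) :
  \sum_(v : T) F (L v) = \sum_(0 <= l < h.+1) level_width l * F l.
Proof.
rewrite -big_enum (perm_big _ perm_levels) /level_list big_flatten big_map.
rewrite /index_iota subn0 big_seq [RHS]big_seq; apply: eq_bigr => l.
rewrite mem_iota => /andP[_ lh]; rewrite /mkseq big_map big_seq.
rewrite (eq_bigr (fun _ => F l)) => [|t].
  by rewrite -big_seq big_const_seq count_predT size_iota iter_addn_0 mulnC.
by rewrite mem_iota => /andP[_ tw]; rewrite node_level.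
Qed.

(** Two entries with a common ancestor on level l both lie in the part of the
    list where the ancestors on level l are periodic. *)
Lemma common_levels l i j : i <= j < size (level_list 1 h) ->
  common l (nth x0 (level_list 1 h) i) (nth x0 (level_list 1 h) j) -> level_width l %| j - i.
Proof.
move=> /andP[ij js] /and3P[li lj /eqP].
have is_ := leq_ltn_trans ij js.
have congr i' j' : i' <= j' -> l <= h -> 
    level_node l (i' %% level_width l) = level_node l (j' %% level_width l) -> i' < j' -> level_width l %| j' - i'.
  move=> ij' lh e ltij.
  have [w0|w_gt0] := posnP (level_width l).
    have [t tw _] := node_onto (nth x0 (level_list 1 h) j).
    have /dvdnP[c ec] := width_dvd lj; move: tw; rewrite ec w0 muln0 ltn0 //.
  by rewrite -eqn_mod_dvd // eq_sym (node_inj lh _ _ e) ?ltn_mod.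
have lh : l <= h by apply: leq_trans lj (rooted_height rT _).
case: (ltngtP i j) ij => // [ltij _|-> _ _]; last by rewrite subnn.
case: l li lj congr lh => [|l] li lj congr lh.
  by rewrite !anc_levels ?add1n // => e; apply: congr => //; apply: ltnW.
have split_levels : level_list 1 h = level_list 1 l ++ level_list l.+1 (h - l).
  rewrite /level_list -flatten_cat -map_cat -[in LHS](subnKC (ltnW lh)).
  by rewrite iotaD add1n.
have in_tail k : k < size (level_list 1 h) -> l < L (nth x0 (level_list 1 h) k) ->
    size (level_list 1 l) <= k.
  move=> ks; rewrite [_ <= k]leqNgt; apply: contraTN => kl.
  rewrite split_levels nth_cat kl.
  have := mem_nth x0 kl; rewrite mem_levels; last by lia.
  by rewrite add1n ltnS -leqNgt => /andP[].
have ti := in_tail _ is_ li; have tj := in_tail _ js lj.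
move: is_ js; rewrite split_levels !nth_cat !ltnNge ti tj /= size_cat => is_ js.
rewrite !anc_levels; [|lia..] => e.
have := congr (i - size (level_list 1 l)) (j - size (level_list 1 l)).
by rewrite subnBA // subnK // => -> //; lia.
Qed.

End Rooted.


(** * Level-wise regular trees as rooted trees *)

Section RegularTree.
Variables (T : sgraph) (z h : nat) (d : nat -> nat).
Hypotheses (z12 : z = 1 \/ z = 2) (Treg : levelwise_regular_tree T z h d).
Implicit Types u v : T.

Definition parent v : T :=
  if [pick u | edge v u && ((level u).+1 == level v)] is Some u then u else v.

(** One of the neighbours of a vertex is its parent or, at level 0 and z = 2,
    the other root. *)
Definition branching l : nat := d l - ((0 < l) || (z == 2)).

Let connT : connected T. Proof. by case: Treg => -[]. Qed.
Let acycT : acyclic T. Proof. by case: Treg => -[]. Qed.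
Let cardC : #|center T| = z. Proof. by case: Treg. Qed.
Let center_neq0 : center T != set0.
Proof. by rewrite -card_gt0 cardC; lia. Qed.

Let level0 v : (level v == 0) = (v \in center T).
Proof. exact: dist_set_eq0. Qed.

Let parentP v : 0 < level v -> edge v (parent v) /\ (level (parent v)).+1 = level v.
Proof.
move=> v0; rewrite /parent; case: pickP => [u /andP[vu /eqP lu]//|no].
have [u vu lu] := dist_set_closer connT center_neq0 v0.
by have := no u; rewrite /= vu [level u]/level lu eqxx.
Qed.

Let bottom u v : level u = 0 -> level v = 0 -> u = v \/ edge u v.
Proof.
by move=> /eqP; rewrite level0 => uc /eqP; rewrite level0 => vc; apply: center_adjacent.
Qed.

Let lower_neighbour u v : edge v u -> 0 < level v -> level u <= level v -> u = parent v.
Proof.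
move=> vu v0 lu; have [vp lp] := parentP v0.
apply: (rank_neighbour_unique acycT (rk := @level T) (v := v)) => //; last by lia.
by move=> x x0; apply: dist_set_closer.
Qed.

Lemma parent_edge_cases u v : edge u v ->
  [\/ 0 < level v /\ u = parent v, 0 < level u /\ v = parent u
    | level u = 0 /\ level v = 0].
Proof.
move=> uv; have vu : edge v u by rewrite edge_sym.
have [v0|v_gt0] := posnP (level v); have [u0|u_gt0] := posnP (level u).
- exact: Or33.
- by apply: Or32; split=> //; apply: lower_neighbour => //; rewrite v0.
- by apply: Or31; split=> //; apply: lower_neighbour => //; rewrite u0.
- have [le|lt] := leqP (level u) (level v).
    by apply: Or31; split=> //; apply: lower_neighbour.
  by apply: Or32; split=> //; apply: lower_neighbour => //; apply: ltnW.
Qed.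

Lemma card_children v : level v < h -> #|children (@level T) parent v| = branching (level v).
Proof.
move=> vh; case: Treg => _ _ _ /(_ v vh) degv _.
have sub : children (@level T) parent v \subset [set u | edge v u].
  apply/subsetP => u; rewrite !inE => /andP[u0 /eqP <-].
  by rewrite edge_sym; case: (parentP u0).
rewrite /branching -degv /deg -(cardsID (children (@level T) parent v) [set u | edge v u]).
rewrite (setIidPr sub).
suff -> : #|[set u | edge v u] :\: children (@level T) parent v| = ((0 < level v) || (z == 2)).
  by rewrite addnK.
have [v0|v0] := posnP (level v).
  rewrite (_ : _ :\: _ = center T :\ v).
    by have := cardsD1 v (center T); rewrite cardC -level0 v0 eqxx; case: z12 => ->; lia.
  apply/setP => u; rewrite in_setD in_setD1 -level0 !inE.
  have [->|uv] /= := eqVneq u v; first by rewrite edge_irr andbF.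
  apply/andP/eqP => [[uC vu]|u0].
    case: (parent_edge_cases vu) uC => [[u_gt0 ->]|[]|[]//]; last by rewrite v0.
    by rewrite u_gt0 eqxx.
  by split; [rewrite u0 | have [e|//] := bottom v0 u0; rewrite e eqxx in uv].
have [vp lp] := parentP v0.
rewrite (_ : _ :\: _ = [set parent v]) ?cards1 //.
apply/setP => u; rewrite !inE; apply/andP/eqP => [[uC vu]|->].
  case: (parent_edge_cases vu) uC => [[u_gt0 ->]|[_ ->] //|[v1 _]]; last by rewrite v1 in v0.
  by rewrite u_gt0 eqxx.
split=> //; apply/negP => /andP[p0 /eqP pp].
by have [_] := parentP p0; rewrite pp; lia.
Qed.

Lemma regular_rooted : rooted h z branching (@level T) parent.
Proof.
split=> //.
- by case: Treg => _ _ <- _ _ v; apply: (@leq_bigmax _ (@level T)).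
- by move=> v /parentP[].
- by move=> v /parentP[].
- exact: parent_edge_cases.
- by rewrite -cardC; apply: eq_card => v; rewrite inE level0.
- move=> u v u0 v0; have [->|uv] := bottom u0 v0; first by rewrite dist_vv.
  case: z12 cardC => -> /eqP; last by rewrite dist_edge.
  case/cards1P => c cE; move: u0 v0 uv => /eqP; rewrite level0 cE inE => /eqP->.
  by move=> /eqP; rewrite level0 cE inE => /eqP->; rewrite edge_irr.
- exact: card_children.
Qed.

End RegularTree.


(** * The product with a complete graph and the lower bound *)

Lemma leq_sub_distn (a c : nat) : a - c <= `|a - c|%N.
Proof. by have [le|lt] := leqP a c; [rewrite (eqP le) | rewrite distnEl // ltnW]. Qed.

Section Diameter.
Variable G : sgraph.

Lemma dist_le_diam (u v : G) : dist u v <= diam G.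
Proof. exact: leq_trans (dist_le_ecc u v) (ecc_le_diam u). Qed.

Lemma diam_eq k (u v : G) : (forall x y : G, dist x y <= k) -> k <= dist u v -> diam G = k.
Proof.
move=> le_k k_le; apply/eqP; rewrite eqn_leq (leq_trans k_le (dist_le_diam u v)) andbT.
by apply/bigmax_leqP => x _; apply/bigmax_leqP => y _.
Qed.

End Diameter.

Section BoxComplete.
Variables (T : sgraph) (n : nat).
Hypothesis connT : connected T.
Local Notation G := (box T (complete_graph n)).
Implicit Types x y : G.

Lemma box_walk x y : exists p,
  [/\ path (@edge G) x p, last x p = y & size p = dist x.1 y.1 + (x.2 != y.2)].
Proof.
case: x y => [u i] [v j]; have [p [ep lp sp]] := shortest_walk connT u v.
have ep' : path (@edge G) (u, i) [seq (w, i) | w <- p].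
  elim: p u ep {lp sp} => //= w p IH u /andP[uw /IH ->].
  by rewrite andbT; apply/orP; right; rewrite eqxx.
have lp' : last ((u, i) : G) [seq (w, i) | w <- p] = (v, i) by rewrite (last_map (fun w : T => (w, i) : G)) lp.
rewrite /=; have [<-|ij] := eqVneq i j.
  by exists [seq (w, i) | w <- p]; split; rewrite // size_map sp addn0.
exists (rcons [seq (w, i) | w <- p] (v, j)); split; last 2 first.
- by rewrite last_rcons.
- by rewrite size_rcons size_map sp addn1.
by rewrite rcons_path ep' lp' /= /box_edge /= eqxx /complete_edge ij.
Qed.

Lemma box_connected : connected G.
Proof. by move=> x y; have [p [ep lp _]] := box_walk x y; apply/connectP; exists p. Qed.

(** Each step of a walk changes either the colour or the vertex of T, and in
    the latter case it moves to a neighbour. *)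
Lemma box_walk_size p x : path (@edge G) x p ->
  dist x.1 (last x p).1 + (x.2 != (last x p).2) <= size p.
Proof.
elim: p x => [|y p IH] x /=; first by rewrite dist_vv eqxx.
case/andP=> /orP[] /andP[/eqP e xy] /IH le_p; rewrite e.
  rewrite -addn1; apply: leq_trans (leq_add le_p (leqnn _)); rewrite -addnA leq_add2l.
  by case: (x.2 != _); rewrite // addn1.
rewrite -add1n; apply: leq_trans (leq_add (dist_edge xy) le_p).
by rewrite addnA leq_add2r dist_triangle.
Qed.

Lemma dist_box x y : dist x y = dist x.1 y.1 + (x.2 != y.2).
Proof.
have [p [ep lp sp]] := box_walk x y.
apply/eqP; rewrite eqn_leq -{1}sp dist_le //=.
have [q [eq lq <-]] := shortest_walk box_connected x y.
by have := box_walk_size eq; rewrite lq.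
Qed.

Lemma diam_box (u v : T) : 1 < n -> dist u v = diam T -> diam G = (diam T).+1.
Proof.
move=> n1 uv.
pose i : 'I_n := Ordinal (ltnW n1); pose j : 'I_n := Ordinal n1.
apply: (@diam_eq G _ (u, i) (v, j)) => [x y|]; rewrite dist_box; last by rewrite /= uv addn1.
by have := dist_le_diam x.1 y.1; case: (_ != _); lia.
Qed.

End BoxComplete.

Section RadioBounds.
Variables (T : sgraph) (h z n : nat) (b : nat -> nat).
Variables (L : T -> nat) (par : T -> T).
Local Notation G := (box T (complete_graph n)).

Lemma sum_product (F : T -> nat) : \sum_(x : G) F x.1 = n * \sum_(v : T) F v.
Proof.
rewrite -(pair_big xpredT xpredT (fun (v : T) (_ : 'I_n) => F v)) /= big_distrr /=.
by apply: eq_bigr => v _; rewrite sum_nat_const card_ord.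
Qed.

Hypotheses (rT : rooted h z b L par) (z_gt0 : 0 < z).

Lemma dist_product_le (x y : G) : dist x y <= L x.1 + L y.1 + z.
Proof.
rewrite (dist_box (rooted_conn rT)); have := dist_upper rT x.1 y.1.
by case: (_ != _); lia.
Qed.

Hypotheses (z_le2 : z <= 2) (h_gt0 : 0 < h).
Hypothesis wide : forall l, l <= h -> z + 2 * l <= level_width z b l.

(** The first two entries of the last level have different ancestors on every
    level with at least two vertices. *)
Lemma far_apart (x0 : T) :
  2 * h + z - 1 <= dist (level_node x0 z b L par h 0) (level_node x0 z b L par h 1).
Proof.
have w1 : 1 < level_width z b h by apply: leq_trans (wide (leqnn h)); lia.
set u := level_node _ _ _ _ _ _ 0; set v := level_node _ _ _ _ _ _ 1.
have Lu : L u = h by rewrite (node_level x0 rT) // ltnW.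
have Lv : L v = h by rewrite (node_level x0 rT).
have [[l /and3P[lu lv /eqP]]|] := dist_lower rT u v; last by lia.
rewrite Lu in lu; rewrite !(anc_node x0 rT) ?lu ?leqnn ?(ltnW w1) //.
have [w_gt1|w_le1] := ltnP 1 (level_width z b l).
  rewrite mod0n modn_small // => /(node_inj rT lu).
  by rewrite w_gt1 (ltnW w_gt1) => /(_ isT isT).
by have := wide lu; lia.
Qed.

Lemma diam_tree : T -> diam T = 2 * h + z - 1.
Proof.
move=> x0; apply: diam_eq (far_apart x0) => x y.
apply: leq_trans (dist_upper rT x y) _.
by have := rooted_height rT x; have := rooted_height rT y; lia.
Qed.

Hypothesis n_gt1 : 1 < n.

Lemma diam_product : T -> diam G = 2 * h + z.
Proof.
move=> x0; rewrite (@diam_box _ _ (rooted_conn rT) _ _ n_gt1 (_ : dist (level_node x0 z b L par h 0) (level_node x0 z b L par h 1) = _)).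
  by rewrite diam_tree //; lia.
by apply/eqP; rewrite eqn_leq dist_le_diam diam_tree // far_apart.
Qed.

(** The diameter is 2h + z and dist x y <= L x + L y + z, so that consecutive
    labels differ by at least 2h + 1 - L x - L y. Summing these differences
    subtracts every level twice, except those of the two ends. *)
Lemma sorted_labels_spread (f : G -> nat) (x : G) s :
  radio_labelling f -> path (fun u v => f u <= f v) x s -> uniq (x :: s) ->
  (2 * h + 1) * size s + L x.1 + L (last x s).1 + f x
    <= f (last x s) + 2 * \sum_(y <- x :: s) L y.1.
Proof.
move=> rf; elim: s x => [|y s IH] x /=; first by rewrite big_seq1; lia.
move=> /andP[xy ys] /andP[xs us]; have := IH y ys us.
rewrite [\sum_(_ <- [:: x, y & s]) _]big_cons.
have nxy : x != y by apply: contraNneq xs => ->; rewrite mem_head.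
have := rf _ _ nxy; have := dist_product_le x y; rewrite (diam_product x.1).
rewrite distnEr //.
move: xy; rewrite mulnS; move: (dist x y) (\sum_(_ <- _) _) ((2 * h + 1) * size s).
move: (f x) (f y) (f (last y s)) (L x.1) (L y.1) (L (last y s).1); clear; lia.
Qed.

Lemma radio_span_lower (f : G -> nat) : radio_labelling f ->
  (2 * h + 1) * (n * #|T| - 1) <= span f + 2 * (n * \sum_(v : T) L v).
Proof.
move=> rf; pose s := sort (fun u v => f u <= f v) (enum G).
have s_sorted : sorted (fun u v => f u <= f v) s by apply: sort_sorted => u v; apply: leq_total.
have s_uniq : uniq s by rewrite sort_uniq enum_uniq.
have s_size : size s = n * #|T| by rewrite size_sort -cardE card_prod card_ord mulnC.
have s_sum : \sum_(y <- s) L y.1 = n * \sum_(v : T) L v.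
  by rewrite -(sum_product L) (perm_big _ (permEl (perm_sort _ _))) big_enum.
case: s s_sorted s_uniq s_size s_sum => [|x s] /=; first by move=> _ _ <-; rewrite sub0n muln0.
move=> xs us <- <-; have := sorted_labels_spread rf xs us; rewrite subn1 /=.
have : `|f x - f (last x s)|%N <= span f.
  apply: leq_trans (leq_bigmax x); exact: (@leq_bigmax _ (fun v => `|f x - f v|%N)).
have dl := leq_sub_distn (f (last x s)) (f x); rewrite distnC in dl.
move: dl; move: (`|f x - f (last x s)|%N) (\sum_(_ <- _) _) ((2 * h + 1) * size s) (span f).
move: (f x) (f (last x s)) (L x.1) (L (last x s).1); clear; lia.
Qed.

End RadioBounds.


(** * Labellings that follow an order of the vertices *)

Lemma cat_eq_split (A : Type) (s1 s2 t1 t2 : seq A) (y : A) :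
  s1 ++ s2 = t1 ++ y :: t2 ->
  (exists2 r, s1 = t1 ++ y :: r & t2 = r ++ s2) \/
  (exists2 r, t1 = s1 ++ r & s2 = r ++ y :: t2).
Proof.
elim: s1 t1 => [|x s1 IH] [|x' t1] /=.
- by move=> ->; right; exists [::].
- by move=> ->; right; exists (x' :: t1).
- by case=> <- <-; left; exists s1.
- case=> <- /IH[[r -> ->]|[r -> ->]]; first by left; exists r.
  by right; exists r.
Qed.

Lemma rn_eq (G : sgraph) k (f : G -> nat) :
  radio_labelling f -> span f <= k ->
  (forall g : G -> nat, radio_labelling g -> k <= span g) -> rn G = k.
Proof.
move=> rf fk lower; rewrite /rn; case: ex_minnP => m /asboolP[g rg <-] min_m.
apply/eqP; rewrite eqn_leq lower // andbT; apply: leq_trans fk.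
by apply: min_m; apply/asboolP; exists f.
Qed.

Section Orderings.
Variables (T : sgraph) (h z n : nat) (b : nat -> nat).
Variables (L : T -> nat) (par : T -> T).
Local Notation G := (box T (complete_graph n)).
Implicit Types (x y : G) (s m : seq G).

Definition gap x y : nat := 2 * h + 1 - (L x.1 + L y.1).

Definition run x s : nat := sumn (pairmap gap x s).

Definition slack m : nat := \sum_(v <- m) (2 * h + 1 - 2 * L v.1).

(** The radio condition for x and y when exactly the vertices of m lie between
    them in the order (see run_slack). *)
Definition admissible x m y : Prop :=
  z + L x.1 + L y.1 <= slack m + (x.2 != y.2) + dist x.1 y.1.

Definition admissible_order s : Prop :=
  forall s1 x m y s2, s = s1 ++ x :: m ++ y :: s2 -> admissible x m y.

(** Each vertex of s gets the least label that the lower bound allows after its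
    predecessor. *)
Definition greedy_label s v : nat :=
  if s is x :: t then run x (take (index v s) t) else 0.

Lemma run_cat x s1 s2 : run x (s1 ++ s2) = run x s1 + run (last x s1) s2.
Proof. by rewrite /run pairmap_cat sumn_cat. Qed.

Lemma greedy_labelE s s1 x m y s2 : uniq s -> s = s1 ++ x :: m ++ y :: s2 ->
  greedy_label s y = greedy_label s x + run x (rcons m y).
Proof.
move=> us es.
have ix : index x s = size s1.
  move: us; rewrite es cat_uniq => /and3P[_ /hasPn/(_ x (mem_head _ _)) xs1 _].
  by rewrite index_cat (negbTE xs1) /= eqxx addn0.
have es' : s = (s1 ++ x :: m) ++ y :: s2 by rewrite es -catA.
have iy : index y s = size (s1 ++ x :: m).
  move: us; rewrite es' cat_uniq => /and3P[_ /hasPn/(_ y (mem_head _ _)) ys1 _].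
  by rewrite index_cat (negbTE ys1) /= eqxx addn0.
move: ix iy; rewrite /greedy_label es {us es es'}.
case: s1 => [|w s1] /= -> ->.
  by rewrite take0 -cat_rcons take_size_cat ?size_rcons.
rewrite -!cat_rcons catA take_size_cat; last by rewrite !size_cat !size_rcons /=; lia.
by rewrite -catA take_size_cat ?size_rcons // run_cat last_rcons.
Qed.

Lemma span_le (f : G -> nat) k : (forall x, f x <= k) -> span f <= k.
Proof.
move=> fk; apply/bigmax_leqP => x _; apply/bigmax_leqP => y _.
wlog le_xy : x y / f x <= f y.
  by move=> W; case/orP: (leq_total (f x) (f y)) => /W //; rewrite distnC.
by rewrite distnEr //; apply: leq_trans (leq_subr _ _) (fk y).
Qed.

Lemma slack_cat m1 m2 : slack (m1 ++ m2) = slack m1 + slack m2.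
Proof. by rewrite /slack big_cat. Qed.

Lemma admissible_cat s1 s2 : admissible_order s1 -> admissible_order s2 ->
  (forall t1 x t2 t3 y t4, s1 = t1 ++ x :: t2 -> s2 = t3 ++ y :: t4 ->
     admissible x (t2 ++ t3) y) ->
  admissible_order (s1 ++ s2).
Proof.
move=> adm1 adm2 cross t1 x m y t2 e.
have [[r e1 e2]|[r _ e2]] := cat_eq_split e; last exact: adm2 e2.
have [[r' er et]|[r' em es]] := cat_eq_split (esym e2).
  by apply: (adm1 t1 x m y r'); rewrite e1 er.
by rewrite em; apply: cross e1 es.
Qed.

Hypotheses (rT : rooted h z b L par) (z_le2 : z <= 2).

Lemma slack_size m : size m <= slack m.
Proof.
elim: m => [|v m IH] //; rewrite /slack big_cons /=; move: IH; rewrite /slack.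
have := rooted_height rT v.1; move: (L v.1) (\sum_(_ <- _) _) (size m); clear; lia.
Qed.

(** The distance falls short of L x + L y by at most twice the level of some
    common ancestor, and without such an ancestor it exceeds L x + L y. *)
Lemma admissible_common x m y :
  0 < slack m + (x.2 != y.2) ->
  (forall l, common L par l x.1 y.1 -> z + 2 * l <= slack m + (x.2 != y.2)) ->
  admissible x m y.
Proof.
rewrite /admissible; move: (slack m) (x.2 != y.2 : nat) => S D S_gt0 com.
have [[l /com le_l le_d]|] := dist_lower rT x.1 y.1; first by lia.
by move: (dist _ _) (L _) (L _) => d Lx Ly; lia.
Qed.

(** A vertex of level 0 in between contributes 2h + 1, which is at least
    z + 2l unless l = h and z = 2; then x and y are copies of the same leaf and
    differ in colour. *)
Lemma admissible_root x m y v : x != y -> v \in m -> L v.1 = 0 -> admissible x m y.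
Proof.
move=> xy /splitPr vm Lv; case: vm => m1 m2.
have S_ge : 2 * h + 1 <= slack (m1 ++ v :: m2).
  rewrite slack_cat {2}/slack big_cons Lv.
  by move: (slack m1) (\sum_(_ <- _) _); clear; lia.
apply: admissible_common => [|l /and3P[lx ly /eqP e]].
  by move: S_ge; move: (slack _); clear; lia.
suff : z + 2 * l <= 2 * h + 1 + (x.2 != y.2).
  by move: S_ge; move: (slack _) (x.2 != y.2 : nat); clear; lia.
have hx := rooted_height rT x.1; have hy := rooted_height rT y.1.
have [lh|hl] := ltnP l h; first by move: (x.2 != y.2 : nat) z_le2 lh; clear; lia.
have ex : L x.1 = l by apply/eqP; rewrite eqn_leq lx (leq_trans hx hl).
have ey : L y.1 = l by apply/eqP; rewrite eqn_leq ly (leq_trans hy hl).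
have e1 : x.1 = y.1 by move: e; rewrite -{1}ex -ey !anc_self.
have -> : x.2 != y.2.
  by apply: contraNneq xy => e2; apply/eqP; apply: injective_projections.
by move: z_le2 lx hx; move: (L _); clear; lia.
Qed.

(** A pair across the boundary has b0 strictly between its members unless it
    ends at b0, and has a strictly between them unless it starts at a. If z = 1
    one vertex between x and b0 is enough slack, since b0 is the root. *)
Lemma admissible_glue s1 a b0 s2 :
  admissible_order (rcons s1 a) -> admissible_order (b0 :: s2) ->
  uniq (rcons s1 a ++ b0 :: s2) -> L b0.1 = 0 -> z = 1 \/ L a.1 = 0 ->
  admissible a [::] b0 -> admissible_order (rcons s1 a ++ b0 :: s2).
Proof.
move=> adm1 adm2 us Lb za ab; apply: admissible_cat => // t1 x t2 t3 y t4 e1 e2.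
have xy : x != y.
  apply/eqP => exy; move: us; rewrite e1 e2 cat_uniq => /and3P[_ /hasPn/(_ y)].
  by rewrite exy !mem_cat !mem_head !orbT => /(_ isT).
case: t3 e2 => [|b1 t3] [eb e2]; last first.
  by apply: (@admissible_root _ _ _ b0) => //; rewrite eb mem_cat mem_head orbT.
rewrite cats0 -{}eb {y e2} in xy *.
case/lastP: t2 e1 => [|t2 a']; first by rewrite cats1 => /rcons_inj[_ <-].
rewrite -rcons_cons -rcons_cat => /rcons_inj[_ <-].
case: za => [z1|La]; last first.
  by apply: (@admissible_root _ _ _ a) => //; rewrite mem_rcons mem_head.
apply: admissible_common => [|l /and3P[_]].
  by apply: leq_trans (leq_trans (slack_size _) (leq_addr _ _)); rewrite size_rcons.
rewrite Lb leqn0 => /eqP-> _; rewrite z1.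
by apply: leq_trans (leq_trans (slack_size _) (leq_addr _ _)); rewrite size_rcons.
Qed.

(** The slack between two entries is at least the number of entries between
    them; this is what makes distance in the list useful. *)
Definition spaced (x0 : T) (B : seq T) : Prop := forall l i j,
  i < j < size B -> common L par l (nth x0 B i) (nth x0 B j) -> level_width z b l %| j - i.

Definition row (x0 : T) (B : seq T) (col : nat -> 'I_n) : seq G :=
  mkseq (fun p => (nth x0 B p, col p)) (size B).

Hypothesis wide : forall l, l <= h -> z + 2 * l <= level_width z b l.
Hypothesis wider : forall l, 2 <= l <= h -> z + 2 * l < level_width z b l.

(** A common ancestor on level l puts x and y a multiple of the width of level
    l apart, and so at least z + 2 * l places. At most one unit of slack is
    missing then, and only if they are exactly z + 2 * l places apart. This
    leaves l <= 1, where different colours supply it. *)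
Lemma row_admissible (x0 : T) (B : seq T) (col : nat -> 'I_n) : spaced x0 B ->
  (forall i j, i < j < size B -> col i = col j ->
     [/\ 1 < j - i, j - i != z & j - i != z + 2]) ->
  admissible_order (row x0 B col).
Proof.
move=> spB colP s1 x m y s2 es.
pose i := size s1; pose j := i + (size m).+1.
have sB : size B = j + (size s2).+1.
  have := congr1 size es; rewrite size_mkseq => ->.
  by rewrite size_cat /= size_cat /= /j /i !addnS addSn addnA.
have ij : i < j < size B by rewrite sB /j; lia.
have jB : j < size B by case/andP: ij.
have iB : i < size B by lia.
have ex : x = (nth x0 B i, col i).
  have <- := nth_mkseq x (fun p => (nth x0 B p, col p)) iB.
  by rewrite -/(row x0 B col) es nth_cat ltnn subnn.
have ey : y = (nth x0 B j, col j).
  have <- := nth_mkseq y (fun p => (nth x0 B p, col p)) jB.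
  rewrite -/(row x0 B col) es nth_cat /j ltnNge leq_addr /= addKn /=.
  by rewrite nth_cat ltnn subnn.
have Sm : j - i <= (slack m).+1 by rewrite /j addKn ltnS slack_size.
have {}colP := colP i j ij; have {}spB l := spB l i j ij.
rewrite ex ey; move: (slack m) Sm (@admissible_common (nth x0 B i, col i) m (nth x0 B j, col j)) => S Sm suff.
apply: suff => /=.
  by case: eqVneq => [/colP[]|] /=; lia.
move=> l com; have lh : l <= h.
  by case/and3P: com => ll _ _; apply: leq_trans ll (rooted_height rT _).
have w_le : level_width z b l <= j - i by apply: dvdn_leq; [lia | apply: spB].
have [l2|l1] := leqP 2 l; first by have := @wider l; rewrite l2 lh => /(_ isT); lia.
have := wide lh; case: eqVneq => [/colP[]|] /=; last by lia.
by case: l l1 {com lh} w_le => [|[|//]] _; lia.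
Qed.

(** An inner vertex takes part in two gaps, an end of the list in one. *)
Lemma run_slack x m y : run x (rcons m y) + L x.1 + L y.1 = 2 * h + 1 + slack m.
Proof.
elim: m x => [|w m IH] x; rewrite /run /slack /= ?big_nil ?big_cons.
  have := rooted_height rT x.1; have := rooted_height rT y.1; rewrite /gap addn0.
  by move: (L _) (L _); clear; lia.
have := IH w; rewrite /run /slack /gap.
have := rooted_height rT x.1; have := rooted_height rT w.1.
move: (L x.1) (L y.1) (L w.1) (\sum_(_ <- _) _) (sumn _); clear; lia.
Qed.

Hypotheses (z_gt0 : 0 < z) (h_gt0 : 0 < h) (n_gt1 : 1 < n).

(** By run_slack, admissible x m y is the radio condition for the pair x, y, as
    the diameter is 2h + z. *)
Lemma greedy_radio s : uniq s -> (forall x, x \in s) -> admissible_order s ->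
  radio_labelling (greedy_label s).
Proof.
move=> us alls adm.
have ordered s1 x m y s2 : s = s1 ++ x :: m ++ y :: s2 ->
    diam G + 1 - dist x y <= greedy_label s y - greedy_label s x.
  move=> es; rewrite (greedy_labelE us es) addKn.
  rewrite (diam_product rT z_gt0 z_le2 h_gt0 wide n_gt1 x.1) (dist_box (rooted_conn rT)).
  have := run_slack x m y; have := adm _ _ _ _ _ es; rewrite /admissible.
  move: (run _ _) (slack m) (dist _ _) (x.2 != y.2 : nat) (L x.1) (L y.1); clear; lia.
have dec x : exists s1 s2, s = s1 ++ x :: s2.
  by case/splitPr: (alls x) => s1 s2; exists s1, s2.
move=> x y xy; have [s1 [t es]] := dec x.
have [/splitPr ys|ys] := boolP (y \in s1).
  case: ys es => p1 p2; rewrite -catA /= => /ordered.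
  rewrite (dist_sym (box_connected (rooted_conn rT))) => le_d.
  exact: leq_trans le_d (leq_sub_distn _ _).
have := alls y; rewrite {1}es mem_cat (negbTE ys) inE eq_sym (negbTE xy) /= => /splitPr yt.
case: yt es => p1 p2 /ordered le_d; rewrite distnC; exact: leq_trans le_d (leq_sub_distn _ _).
Qed.

(** The gaps of the order add up to the lower bound: it subtracts every level
    twice, and the two ends, which only take part in one gap, are on level 0. *)
Lemma rn_of_order x m y (s := x :: rcons m y) :
  uniq s -> (forall v, v \in s) -> admissible_order s ->
  L x.1 = 0 -> L y.1 = 0 ->
  rn G = n * (\sum_(v : T) (2 * h + 1 - 2 * L v)) - (2 * h + 1).
Proof.
move=> us alls adm Lx Ly.
have ps : perm_eq (enum G) s.
  by apply: uniq_perm; rewrite ?enum_uniq // => v; rewrite mem_enum alls.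
have slack_s : slack s = n * (\sum_(v : T) (2 * h + 1 - 2 * L v)).
  by rewrite /slack -(perm_big _ ps) big_enum -sum_product.
have run_s : run x (rcons m y) + (2 * h + 1) = slack s.
  have := run_slack x m y; rewrite Lx Ly /slack /s big_cons -cats1 big_cat big_seq1 /= Lx Ly.
  by move: (\sum_(_ <- _) _); clear; lia.
rewrite -slack_s -run_s addnK.
apply: (rn_eq (greedy_radio us alls adm)) => [|g rg].
  apply: span_le => v; rewrite /greedy_label /s -[X in _ <= run _ X](cat_take_drop (index v (x :: rcons m y))).
  by rewrite run_cat leq_addr.
have := radio_span_lower rT z_gt0 z_le2 h_gt0 wide n_gt1 rg.
have : \sum_(v : T) (2 * h + 1 - 2 * L v) + 2 * (\sum_(v : T) L v) = #|T| * (2 * h + 1).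
  rewrite big_distrr -big_split /= -sum_nat_const; apply: eq_bigr => v _.
  by have := rooted_height rT v; lia.
move: slack_s; rewrite -run_s; move: (span g) (run _ _) (\sum_(v : T) L v) (\sum_(v : T) _) #|T|.
clear; nia.
Qed.

End Orderings.


(** * Orders that attain the lower bound *)

Section Constructions.
Variables (T : sgraph) (h z n : nat) (b : nat -> nat).
Variables (L : T -> nat) (par : T -> T).
Hypothesis n_gt2 : 2 < n.
Local Notation G := (box T (complete_graph n)).
Variable x0 : T.
Implicit Types (x y : G) (s m : seq G) (B : seq T).

Let n_gt0 : 0 < n. Proof. exact: ltn_trans n_gt2. Qed.

Let n_gt1 : 1 < n. Proof. exact: ltnW. Qed.

Definition color c : 'I_n := Ordinal (ltn_pmod c n_gt0).

Lemma color_eq a c : (color a == color c) = (a == c %[mod n]).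
Proof. by []. Qed.

Lemma color_neq a c : a < c < a + n -> color a != color c.
Proof.
move=> /andP[ac ca]; rewrite color_eq eq_sym eqn_mod_dvd; last exact: ltnW.
by apply/negP => /dvdn_leq; rewrite subn_gt0 => /(_ ac); lia.
Qed.

Lemma color_onto c (i : 'I_n) : c <= n -> exists2 q, q < n & color (c + q) = i.
Proof.
move=> cn; exists ((i + (n - c)) %% n); first by rewrite ltn_mod.
apply: val_inj; rewrite /= modnDmr addnCA subnKC // addnC modnDl modn_small //.
Qed.

Lemma row_cons (v : T) B (col : nat -> 'I_n) :
  row x0 (v :: B) col = (v, col 0) :: row x0 B (col \o succn).
Proof. by rewrite /row /mkseq /= (iotaDl 1 0) -map_comp. Qed.

Lemma row_rcons (v : T) B (col : nat -> 'I_n) :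
  row x0 (rcons B v) col = rcons (row x0 B col) (v, col (size B)).
Proof.
elim: B col => [|w B IH] col; first by [].
by rewrite rcons_cons !row_cons IH.
Qed.

Lemma size_row B (col : nat -> 'I_n) : size (row x0 B col) = size B.
Proof. exact: size_mkseq. Qed.

Lemma mem_row B (col : nat -> 'I_n) v : v \in B -> (v, col (index v B)) \in (row x0 B col : seq G).
Proof.
move=> vB; apply/mapP; exists (index v B); first by rewrite mem_iota index_mem.
by rewrite nth_index.
Qed.

Lemma cover_uniq s : (forall x, x \in s) -> size s <= n * #|T| -> uniq s.
Proof.
move=> alls le_s; apply: (leq_size_uniq (enum_uniq G)) => [x _|]; first exact: alls.
by rewrite -cardE card_prod card_ord mulnC.
Qed.

Lemma row_split B (col : nat -> 'I_n) t1 x t2 : row x0 B col = t1 ++ x :: t2 ->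
  [/\ size B = size t1 + (size t2).+1, x = (nth x0 B (size t1), col (size t1))
    & forall i, i < size t1 -> nth x t1 i = (nth x0 B i, col i)].
Proof.
move=> e; have sB : size B = size t1 + (size t2).+1.
  by rewrite -(size_row B col) e size_cat.
have nthB i : i < size B -> nth x (t1 ++ x :: t2) i = (nth x0 B i, col i).
  by move=> iB; rewrite -e (nth_mkseq x (fun p => (nth x0 B p, col p))).
split=> // [|i it]; first by rewrite -nthB ?sB ?addnS ?ltnS ?leq_addr // nth_cat ltnn subnn.
by rewrite -nthB; [rewrite nth_cat it | rewrite sB ltn_addr].
Qed.

Lemma slack_prefix (k c : nat) (x : G) m :
  (forall i, i < minn k (size m) -> c <= 2 * h + 1 - 2 * L (nth x m i).1) ->
  minn k (size m) * c <= slack h L m.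
Proof.
elim: m k => [|v m IH] [|k] mP; rewrite ?minn0 ?min0n // minnSS mulSn /slack big_cons.
apply: leq_add; first by apply: (mP 0); rewrite /= minnSS.
by apply: IH => i ik; apply: (mP i.+1); rewrite /= minnSS.
Qed.

Hypotheses (rT : rooted h z b L par) (z_le2 : z <= 2).

(** Blocks that start at copies of a root; with two roots they also end at one,
    so that only the pair at the boundary itself needs attention. *)
Lemma admissible_blocks (blk : nat -> seq G) (hd la : nat -> G) (tl bl : nat -> seq G) Z k c :
  (forall q, k <= q < k + c ->
     [/\ admissible_order h z L (blk q), blk q = hd q :: tl q, blk q = rcons (bl q) (la q),
         z = 1 \/ L (la q).1 = 0 & admissible h z L (la q) [::] (hd q.+1)]) ->
  (forall q, L (hd q).1 = 0) ->
  (exists Z', Z = hd (k + c) :: Z') ->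
  admissible_order h z L Z ->
  uniq (flatten [seq blk q | q <- iota k c] ++ Z) ->
  admissible_order h z L (flatten [seq blk q | q <- iota k c] ++ Z).
Proof.
elim: c k => [|c IH] k //= blkP Lhd ZE admZ; rewrite -catA => us.
have [adm1 _ la1 zla adm_hd] := blkP k ltac:(lia).
move: us; rewrite la1 => us.
set R := _ ++ Z in us *.
have admR : admissible_order h z L R.
  apply: IH => //; last by move: us; rewrite cat_uniq => /and3P[].
    by move=> q kq; apply: blkP; lia.
  by rewrite addSnnS.
have [R' eR] : exists R', R = hd k.+1 :: R'.
  rewrite /R; case: (c) blkP ZE => [|c'] blkP ZE /=.
    by case: ZE => Z' ->; exists Z'; rewrite addn1.
  have [_ -> _ _ _] := blkP k.+1 ltac:(lia).
  by eexists; rewrite /= -!catA.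
rewrite eR in us admR *.
by apply: (admissible_glue rT z_le2) => //; rewrite -?la1.
Qed.

Hypotheses (z_gt0 : 0 < z) (h_gt0 : 0 < h).
Hypothesis wide : forall l, l <= h -> z + 2 * l <= level_width z b l.
Hypothesis wider : forall l, 2 <= l <= h -> z + 2 * l < level_width z b l.
Local Notation node := (level_node x0 z b L par).
Local Notation levels := (level_list x0 z b L par).
Local Notation width := (level_width z b).

Lemma card_tree : #|T| = z + size (levels 1 h).
Proof.
by rewrite cardE (perm_size (perm_levels x0 rT)) /= size_cat size_mkseq /level_width big_ord0 muln1.
Qed.

(** ** Two roots: n traversals from one root to the other *)

Section TwoRoots.
Hypothesis z2 : z = 2.

Let S := size (levels 1 h).

(** The traversal starts at the second root because level 1 starts below the
    first one: in this way the two halves of the tree alternate throughout. *)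
Definition two_root_order : seq T := node 0 1 :: rcons (levels 1 h) (node 0 0).

Lemma even_levels : ~~ odd S.
Proof.
rewrite -dvdn2 /S size_levels; apply: dvdn_sum => l _.
by apply: dvdn_trans (width_dvd z b (leq0n l)); rewrite /level_width big_ord0 z2.
Qed.

Lemma two_root_spaced : spaced z b L par x0 two_root_order.
Proof.
have w0 : width 0 = 2 by rewrite /level_width big_ord0 z2.
have size_order : size two_root_order = S.+2 by rewrite /= size_rcons.
have L00 : L (node 0 0) = 0 by rewrite (node_level x0 rT) ?w0.
have L01 : L (node 0 1) = 0 by rewrite (node_level x0 rT) ?w0.
have nthS i : i < S -> nth x0 two_root_order i.+1 = nth x0 (levels 1 h) i.
  by move=> iS /=; rewrite nth_rcons iS.
have nth_last : nth x0 two_root_order S.+1 = node 0 0.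
  by rewrite /= nth_rcons ltnn eqxx.
have anc0 i : i < S.+2 -> anc L par 0 (nth x0 two_root_order i) = node 0 (i.+1 %% 2).
  case: i => [_|i]; first by rewrite /= -{1}L01 anc_self.
  rewrite !ltnS leq_eqVlt => /predU1P[->|iS].
    by rewrite nth_last -{1}L00 anc_self modn2 /= even_levels.
  by rewrite nthS // (anc_levels rT) ?w0 -?[i.+2]addn2 ?modnDr // add1n.
move=> l i j; rewrite size_order => /andP[ij jS].
move=> /and3P[]; case: l => [|l] li lj /eqP.
  rewrite w0 !anc0 ?(ltn_trans ij jS) // => /(node_inj rT (leq0n h)).
  rewrite w0 !ltn_mod => /(_ isT isT) e.
  by rewrite -subSS -eqn_mod_dvd ?e // ltnS ltnW.
have i0 : 0 < i by case: (i) li => //=; rewrite L01.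
have jS' : j <= S.
  by move: jS; rewrite ltnS leq_eqVlt => /predU1P[ej|//]; move: lj; rewrite ej nth_last L00.
case: i j i0 ij jS' li lj {jS} => [|i] [|j] // _; rewrite ltnS => ij jS.
rewrite !nthS // ?(ltn_trans ij jS) // => li lj e.
rewrite subSS; apply: (common_levels (x0 := x0) rT); first by rewrite (ltnW ij).
by apply/and3P; split=> //; apply/eqP.
Qed.

Lemma rn_two_roots :
  rn G = n * (\sum_(v : T) (2 * h + 1 - 2 * L v)) - (2 * h + 1).
Proof.
have w0 : width 0 = 2 by rewrite /level_width big_ord0 z2.
(* Colours advance by k modulo 3 along a traversal, and the next traversal is
   shifted by one. The choice of k keeps the last colour of a traversal
   different from the first colour, 1, of the next one. *)
have [k k12 k_last] : exists2 k, k = 1 \/ k = 2 & (k * S.+1) %% 3 != 1.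
  have [e|e] := eqVneq (S.+1 %% 3) 1; last by exists 1; [left | rewrite mul1n].
  by exists 2; [right | rewrite -modnMmr e].
pose col q p := color ((k * p) %% 3 + q).
pose blk q := row x0 two_root_order (col q).
pose hd q : G := (node 0 1, col q 0).
pose la q : G := (node 0 0, col q S.+1).
pose mid q : seq G := row x0 (levels 1 h) (col q \o succn).
have blkE q : blk q = hd q :: rcons (mid q) (la q).
  by rewrite /blk row_cons row_rcons.
have size_order : size two_root_order = S.+2 by rewrite /= size_rcons.
pose s := flatten [seq blk q | q <- iota 0 n.-1] ++ blk n.-1.
have sE : s = flatten [seq blk q | q <- iota 0 n].
  have -> : iota 0 n = iota 0 n.-1 ++ [:: n.-1] by rewrite -{1}(prednK n_gt0) -addn1 iotaD.
  by rewrite map_cat flatten_cat /= cats0.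
have order_all v : v \in two_root_order.
  have [v0|v_gt0] := posnP (L v).
    have [t] := node_onto x0 rT v; rewrite v0 w0 inE mem_rcons inE.
    by case: t => [|[|//]] _ <-; rewrite eqxx ?orbT.
  by rewrite inE mem_rcons inE (mem_levels x0 rT) ?add1n // v_gt0 ltnS (rooted_height rT) !orbT.
have s_all x : x \in s.
  case: x => v i; rewrite sE.
  have [|q qn <-] := @color_onto ((k * index v two_root_order) %% 3) i.
    by have := ltn_pmod (k * index v two_root_order) (isT : 0 < 3); lia.
  apply/flattenP; exists (blk q); last exact: mem_row.
  by apply: map_f; rewrite mem_iota.
have s_uniq : uniq s.
  apply: cover_uniq => //; rewrite sE size_flatten /shape -map_comp.
  rewrite sumnE big_map (eq_bigr (fun _ => S.+2)) => [|q _]; last exact: etrans (size_row _ _) size_order.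
  by rewrite big_const_seq count_predT size_iota iter_addn_0 mulnC card_tree -/S z2 add2n.
have lt3 p : p %% 3 < n by apply: leq_trans _ n_gt2; rewrite ltn_mod.
(* Places with equal colours are a multiple of 3 apart, hence not 1, 2 or 4. *)
have adm_blk q : admissible_order h z L (blk q).
  apply: (row_admissible rT z_le2 wide wider two_root_spaced) => i j /andP[ij _].
  move=> e; suff /dvdnP[c ec] : 3 %| j - i by rewrite z2; split; lia.
  move/eqP: e; rewrite color_eq eqn_modDr (modn_small (lt3 _)) (modn_small (lt3 _)) eq_sym.
  rewrite eqn_mod_dvd ?leq_mul2l ?(ltnW ij) ?orbT // -mulnBr Gauss_dvdr //.
  by case: k12 => ->.
pose m := behead (flatten [seq blk q | q <- iota 0 n.-1]) ++ hd n.-1 :: mid n.-1.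
have s_cons : s = hd 0 :: rcons m (la n.-1).
  rewrite /s /m blkE -rcons_cons rcons_cat.
  have -> : flatten [seq blk q | q <- iota 0 n.-1] = blk 0 ++ flatten [seq blk q | q <- iota 1 n.-2].
    by rewrite (_ : iota 0 n.-1 = 0 :: iota 1 n.-2) //; case: (n) n_gt1 => [|[]].
  by rewrite blkE.
have L00 : L (node 0 0) = 0 by rewrite (node_level x0 rT) ?w0.
have L01 : L (node 0 1) = 0 by rewrite (node_level x0 rT) ?w0.
have node01 : node 0 0 != node 0 1.
  by apply/eqP => /(node_inj rT (leq0n h)); rewrite w0 => /(_ isT isT).
have adm_s : admissible_order h z L s.
  apply: (admissible_blocks (hd := hd) (la := la) (tl := fun q => rcons (mid q) (la q))
            (bl := fun q => hd q :: mid q)) => //; last by eexists; exact: blkE.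
  move=> q _; split; [exact: adm_blk|exact: blkE|by rewrite blkE|by right|].
  have D : (la q).2 != (hd q.+1).2.
    rewrite color_eq muln0 mod0n add0n -[q.+1]add1n eqn_modDr.
    by rewrite (modn_small (lt3 _)) (modn_small n_gt1).
  apply: (admissible_common rT z_le2).
    by apply: ltn_addl; rewrite lt0b; exact: D.
  move=> l /and3P[]; rewrite /la /hd /= L00 leqn0 => /eqP-> _.
  have -> : anc L par 0 (node 0 0) = node 0 0 by rewrite -{1}L00 anc_self.
  have -> : anc L par 0 (node 0 1) = node 0 1 by rewrite -{1}L01 anc_self.
  by rewrite (negbTE node01).
move: s_uniq s_all adm_s; rewrite s_cons => us alls adm.
by apply: (rn_of_order rT z_le2 wide z_gt0 h_gt0 n_gt1 us alls adm).
Qed.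

End TwoRoots.

(** ** One root: n traversals between n root copies *)

Section OneRoot.
Hypothesis z1 : z = 1.

Let B := levels 1 h.

Let w1_ge3 : 2 < width 1.
Proof. by have := wide h_gt0; rewrite z1. Qed.

Let w1_dvd : width 1 %| size B.
Proof.
rewrite /B size_levels big_nat; apply: dvdn_sum => l /andP[l1 _].
by apply: dvdn_trans (width_dvd z b l1).
Qed.

Let B_first : exists t, B = mkseq (node 1) (width 1) ++ t.
Proof. by rewrite /B /level_list -(prednK h_gt0); eexists. Qed.

Let w1_le : width 1 <= size B.
Proof. by have [t ->] := B_first; rewrite size_cat size_mkseq leq_addr. Qed.

Let level_first i : i < width 1 -> L (nth x0 B i) = 1.
Proof.
have [t ->] := B_first; move=> iw; rewrite nth_cat size_mkseq iw nth_mkseq //.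
exact: (node_level x0 rT).
Qed.

(** Two alternating colours suffice in a row, since only odd distances require
    different ones. The offsets 0 and 2 both differ from 1 modulo n >= 3, so
    that the end of a row never has the colour q + 1 that starts the next row. *)
Definition one_root_color q p : 'I_n := color (2 * odd p + q).

Local Notation col := one_root_color.

Lemma one_root_color_eq q i j : col q i = col q j -> odd i = odd j.
Proof.
move/eqP; rewrite color_eq eqn_modDr !modn_small; last 2 first.
- by case: (odd _); apply: leq_trans n_gt2.
- by case: (odd _); apply: leq_trans n_gt2.
by case: (odd i) (odd j) => [] [].
Qed.

Lemma one_root_row_admissible q : admissible_order h z L (row x0 B (col q)).
Proof.
apply: (row_admissible rT z_le2 wide wider).
  by move=> l i j /andP[ij jB]; apply: (common_levels rT); rewrite (ltnW ij).
move=> i j /andP[ij _] /one_root_color_eq e.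
by have := oddB (ltnW ij); rewrite e addbb z1 => o; split; lia.
Qed.

(** With n root copies, two of them at the ends, some row has to follow another
    one directly. The level 1 vertices that open the second row contribute
    2h - 1 each: once all of them lie between x and y, no pair needs more. If y
    is one of them, only a common ancestor on level 1 matters, and the positions
    of x and y are congruent modulo the width of level 1, as within a row. At
    distance 3 the missing unit comes from the colours if y opens its row, from
    another vertex of level 1 if h > 1, and for h = 1 from x and y being copies
    of the same leaf. *)
Lemma double_row_admissible q :
  uniq (row x0 B (col q) ++ row x0 B (col q.+1)) ->
  admissible_order h z L (row x0 B (col q) ++ row x0 B (col q.+1)).
Proof.
move=> us; apply: admissible_cat => [||t1 x t2 t3 y t4 e1 e2]; [exact: one_root_row_admissible..|].
have xy : x != y.
  apply/eqP => exy; move: us; rewrite e1 e2 cat_uniq => /and3P[_ /hasPn/(_ y)].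
  by rewrite exy !mem_cat !mem_head !orbT => /(_ isT).
have [s1 ex _] := row_split e1; have [s3 ey nth3] := row_split e2.
set p := size t1 in s1 ex; set p' := size t3 in s3 ey nth3.
have slack3 : minn (width 1) p' * (2 * h - 1) <= slack h L t3.
  apply: (@slack_prefix (width 1) _ y) => i; rewrite leq_min => /andP[iw ip'].
  by rewrite nth3 // level_first //; lia.
have size23 : size t2 + p' <= slack h L (t2 ++ t3).
  by rewrite -size_cat; apply: (slack_size rT).
have slack23 : size t2 + slack h L t3 <= slack h L (t2 ++ t3).
  by rewrite slack_cat leq_add2r; apply: (slack_size rT).
have near : size t2 + p' <= 2 -> p' = 0 -> size t2 != 1 -> x.2 != y.2.
  move=> t2_le p'0 t2_1; rewrite ex ey p'0 /= /col /one_root_color eq_sym.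
  have -> : odd p = odd (size B).+1.
    have : size t2 = 0 \/ size t2 = 2 by lia.
    by rewrite s1; case=> ->; rewrite ?addn1 /= ?addn3 /= ?negbK.
  rewrite muln0 add0n; case: (odd _) => /=; first by rewrite color_neq //; lia.
  by rewrite eq_sym color_neq //; lia.
have pos : 0 < slack h L (t2 ++ t3) + (x.2 != y.2).
  have [t0|] := posnP (size t2 + p'); last by move=> t_gt0; apply: ltn_addr; apply: leq_trans size23.
  by rewrite near ?addn1 //; lia.
apply: (admissible_common rT z_le2) => // l com.
have lh : l <= h by case/and3P: com => ll _ _; apply: leq_trans ll (rooted_height rT _).
have [w_le|lt_w] := leqP (width 1) p'.
  rewrite (minn_idPl w_le) in slack3.
  move: slack3 slack23; move: (slack _ _ _) (slack _ _ _) (x.2 != y.2 : nat) (size t2).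
  by move: w1_ge3 h_gt0 lh; rewrite z1; move: (width 1); clear; nia.
have Ly : L y.1 = 1 by rewrite ey level_first.
case: l com lh => [|[|l]]; [by rewrite z1|move=> com _| by case/and3P; rewrite Ly].
have eB : anc L par 1 x.1 = anc L par 1 y.1 by case/and3P: com => _ _ /eqP.
have sB_gt0 : 0 < size B by rewrite s1 addnS.
have w_gt0 : 0 < width 1 by apply: ltn_trans w1_ge3.
have pB : p < size B by rewrite s1 addnS ltnS leq_addr.
have p'B : p' < size B by rewrite s3 addnS ltnS leq_addr.
have : p' = p %[mod width 1].
  move: eB; rewrite ex ey /= !(anc_levels rT) ?add1n // => /(node_inj rT h_gt0).
  by rewrite !ltn_mod => /(_ w_gt0 w_gt0).
move/(congr1 (fun t => (t + (size t2).+1) %% width 1)); rewrite !modnDml -s1 (eqP w1_dvd).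
move/eqP/dvdn_leq; rewrite addnS => /(_ isT) w_le.
have [lt3|ge3] := leqP (size t2 + p') 2; last first.
  by rewrite z1; apply: leq_trans (leq_trans ge3 size23) (leq_addr _ _).
have [p'0|p'_gt0] := posnP p'.
  by rewrite near ?z1; lia.
have [h1|h_gt1] := leqP h 1.
  have Lx : L x.1 = 1.
    by apply/eqP; rewrite eqn_leq (leq_trans (rooted_height rT _) h1); case/and3P: com.
  have ax : anc L par 1 x.1 = x.1 by rewrite -{1}Lx anc_self.
  have ay : anc L par 1 y.1 = y.1 by rewrite -{1}Ly anc_self.
  have e : x.1 = y.1 by rewrite -ax eB ay.
  have -> : x.2 != y.2.
    by apply: contraNneq xy => e'; apply/eqP; apply: injective_projections.
  by rewrite z1; lia.
rewrite (minn_idPr (ltnW lt_w)) in slack3.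
rewrite z1; move: slack3 slack23 p'_gt0 w_le w1_ge3 h_gt1.
move: (slack _ _ _) (slack _ _ _) (x.2 != y.2 : nat) (size t2) (width 1); clear; nia.
Qed.

Lemma admissible_seq1 x : admissible_order h z L [:: x].
Proof. by move=> [|? [|? ?]] ? [|? ?] ? ?. Qed.

Lemma admissible_to_root x y : L y.1 = 0 -> x.2 != y.2 -> admissible h z L x [::] y.
Proof.
move=> Ly xy; apply: (admissible_common rT z_le2); first by rewrite xy addn1.
by move=> l /and3P[_]; rewrite Ly leqn0 => /eqP-> _; rewrite z1 xy addn1.
Qed.

Lemma admissible_from_root x y m :
  L x.1 = 0 -> x.2 != y.2 -> admissible_order h z L (y :: m) ->
  admissible_order h z L (x :: y :: m).
Proof.
move=> Lx xy adm; rewrite -cat1s; apply: admissible_cat => //; first exact: admissible_seq1.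
move=> [|? [|? ?]] // x' t2 t3 y' t4 [<- <-] e.
have pos : 0 < slack h L ([::] ++ t3) + (x.2 != y'.2).
  case: t3 e => [[<- _]|y0 t3 _]; first by rewrite xy addn1.
  by apply: ltn_addr; apply: leq_trans (slack_size rT _).
apply: (admissible_common rT z_le2) => // l /and3P[].
by rewrite Lx leqn0 => /eqP-> _ _; rewrite z1.
Qed.

(** The root copy with number q < n - 1 stands before row q, the last one after
    row n - 1. It has to avoid the colours of its neighbours, and a row of odd
    length ends with the offset 0, one of even length with the offset 2. *)
Definition root_color q : nat :=
  if odd (size B) then q.+1
  else if q == 0 then n - 2 else if q == n - 1 then n - 1 else q - 1.

Lemma root_color_onto (i : 'I_n) : exists2 q, q < n & color (root_color q) = i.
Proof.
have in_n := ltn_ord i; rewrite /root_color; case: (odd _).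
  have [i0|i_gt0] := posnP i.
    exists n.-1; first by rewrite prednK.
    by apply: val_inj; rewrite /= prednK // modnn i0.
  by exists i.-1; [lia | apply: val_inj; rewrite /= prednK // modn_small].
have [i_lt|] := ltnP i (n - 2).
  exists i.+1; first by lia.
  rewrite (_ : i.+1 == n - 1 = false); last by lia.
  by apply: val_inj; rewrite /= subn1 modn_small.
rewrite leq_eqVlt => /predU1P[ei|i_gt].
  by exists 0; [|apply: val_inj; rewrite /= ei modn_small].
exists (n - 1); first by lia.
rewrite eqxx (_ : n - 1 == 0 = false); last by lia.
by apply: val_inj; rewrite /= modn_small; lia.
Qed.

Lemma root_color_before q : q < n - 1 -> color (root_color q) != col q 0.
Proof.
move=> qn; rewrite /col /root_color /= muln0 add0n.
case: (odd _); first by rewrite eq_sym color_neq //; lia.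
case: (eqVneq q 0) => [->|q0]; first by rewrite eq_sym color_neq //; lia.
by rewrite (_ : q == n - 1 = false) ?color_neq //; lia.
Qed.

Lemma root_color_after q : q < n - 2 -> col q (size B).-1 != color (root_color q.+1).
Proof.
have sB : 0 < size B by apply: leq_trans w1_le; apply: ltn_trans w1_ge3.
move=> qn; rewrite /col /root_color /=; case: ifP => o.
  rewrite (_ : odd _ = false) ?muln0 ?add0n ?color_neq //; first by lia.
  by have := sB; lia.
rewrite (_ : odd _ = true); last by lia.
by rewrite (_ : q.+1 == n - 1 = false) ?subn1 /= 1?eq_sym ?color_neq //; lia.
Qed.

Lemma root_color_last : col n.-1 (size B).-1 != color (root_color n.-1).
Proof.
have sB : 0 < size B by apply: leq_trans w1_le; apply: ltn_trans w1_ge3.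
rewrite /col /root_color /=; case: ifP => o.
  by rewrite (_ : odd _ = false) ?muln0 ?add0n ?color_neq //; lia.
rewrite (_ : odd _ = true); last by lia.
by rewrite (_ : n.-1 == 0 = false) ?subn1 ?eqxx 1?eq_sym ?color_neq //; lia.
Qed.

Lemma rn_one_root :
  rn G = n * (\sum_(v : T) (2 * h + 1 - 2 * L v)) - (2 * h + 1).
Proof.
have w0 : width 0 = 1 by rewrite /level_width big_ord0 z1.
have L0 : L (node 0 0) = 0 by rewrite (node_level x0 rT) ?w0.
have sB_gt0 : 0 < size B by apply: leq_trans w1_le; apply: ltn_trans w1_ge3.
have [v1 [B1 eB1]] : exists v1 B1, B = v1 :: B1 by case: B sB_gt0 => // v1 B1; exists v1, B1.
have [B2 [v2 eB2]] : exists B2 v2, B = rcons B2 v2.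
  by rewrite eB1 lastI; eexists; eexists.
have sB2 : size B2 = (size B).-1 by rewrite eB2 size_rcons.
pose hd q : G := (node 0 0, color (root_color q)).
pose rw q : seq G := row x0 B (col q).
pose la q : G := (v2, col q (size B).-1).
pose rw' q : seq G := row x0 B2 (col q).
pose blk q := hd q :: rw q.
have rw1 q : exists r, rw q = (v1, col q 0) :: r by rewrite /rw eB1 row_cons; eexists.
have rw2 q : rw q = rcons (rw' q) (la q) by rewrite /rw {1}eB2 row_rcons sB2.
pose Z := hd n.-2 :: rw n.-2 ++ rw n.-1 ++ [:: hd n.-1].
pose s := flatten [seq blk q | q <- iota 0 n.-2] ++ Z.
have s_all x : x \in s.
  case: x => v i; have in_s q : q < n -> (hd q \in s) /\ {subset rw q <= s}.
    move=> qn; have [qn2|] := ltnP q n.-2.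
      have sub : {subset blk q <= s}.
        move=> y yq; rewrite mem_cat; apply/orP; left; apply/flattenP; exists (blk q) => //.
        by apply: map_f; rewrite mem_iota.
      by split=> [|y yq]; apply: sub; rewrite inE ?eqxx // yq orbT.
    rewrite leq_eqVlt => /predU1P[<-|qn1].
      by split=> [|y yq]; rewrite mem_cat inE ?eqxx ?orbT // mem_cat yq !orbT.
    have -> : q = n.-1 by lia.
    by split=> [|y yq]; rewrite mem_cat inE !mem_cat ?mem_head ?yq !orbT.
  have [v0|v_gt0] := posnP (L v).
    have -> : v = node 0 0.
      by have [t] := node_onto x0 rT v; rewrite v0 w0; case: t => // _ <-.
    by have [q qn <-] := root_color_onto i; case: (in_s q qn).
  have vB : v \in B by rewrite (mem_levels x0 rT) ?add1n // v_gt0 ltnS (rooted_height rT).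
  have [|q qn <-] := @color_onto (2 * odd (index v B)) i.
    by case: (odd _); apply: leq_trans (ltnW n_gt2).
  by have [_ sub] := in_s q qn; apply: sub; apply: (mem_row (col q) vB).
have s_uniq : uniq s.
  apply: cover_uniq => //; rewrite size_cat size_flatten /shape -map_comp.
  rewrite sumnE big_map (eq_bigr (fun _ => (size B).+1)) => [|q _]; last first.
    by apply: (congr1 succn); apply: size_row.
  rewrite big_const_seq count_predT size_iota iter_addn_0 /= !size_cat !size_row card_tree -/B z1 /=.
  by move: n_gt2; move: (size B); clear; nia.
have adm_Z : admissible_order h z L Z.
  have uZ : uniq Z by move: s_uniq; rewrite cat_uniq => /and3P[].
  have eZ : Z = rcons (hd n.-2 :: rw n.-2 ++ rw' n.-1) (la n.-1) ++ [:: hd n.-1].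
    by rewrite /Z (rw2 n.-1) -!cats1 /= -!catA.
  have admR : admissible_order h z L (rcons (hd n.-2 :: rw n.-2 ++ rw' n.-1) (la n.-1)).
    have -> : rcons (hd n.-2 :: rw n.-2 ++ rw' n.-1) (la n.-1) = hd n.-2 :: rw n.-2 ++ rw n.-1.
      by rewrite rcons_cons rcons_cat -rw2.
    have [r er] := rw1 n.-2; have D := @root_color_before n.-2 ltac:(lia).
    have : admissible_order h z L (rw n.-2 ++ rw n.-1).
      rewrite {2}(_ : n.-1 = n.-2.+1); last by lia.
      apply: double_row_admissible; rewrite -(_ : n.-1 = n.-2.+1); last by lia.
      by move: uZ; rewrite /Z cons_uniq catA cat_uniq => /andP[_ /and3P[]].
    by rewrite er cat_cons; apply: admissible_from_root.
  rewrite eZ in uZ *.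
  apply: (admissible_glue rT z_le2) => //; [exact: admissible_seq1|by left|].
  by apply: admissible_to_root => //; exact: root_color_last.
have adm_s : admissible_order h z L s.
  apply: (admissible_blocks (hd := hd) (la := la) (tl := rw) (bl := fun q => hd q :: rw' q)) => //.
  - move=> q /andP[_ qn]; split; [|by []|by rewrite /blk rw2|by left|].
      have [r er] := rw1 q; have := @one_root_row_admissible q; rewrite -/(rw q) /blk er.
      by apply: admissible_from_root => //; apply: root_color_before; lia.
    by apply: admissible_to_root => //; apply: root_color_after; lia.
  - by eexists.
have [m em] : exists m, s = hd 0 :: rcons m (hd n.-1).
  rewrite /s /Z (_ : n.-2 = n.-2.-1.+1) /=; last by lia.
  rewrite -!catA; exists (rw 0 ++ flatten [seq blk q | q <- iota 1 n.-2.-1] ++ hd n.-2.-1.+1 :: rw n.-2.-1.+1 ++ rw n.-1).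
  by rewrite -cats1 /= -!catA /= -!catA.
move: s_uniq s_all adm_s; rewrite em => us alls adm.
by apply: (rn_of_order rT z_le2 wide z_gt0 h_gt0 n_gt1 us alls adm).
Qed.

End OneRoot.

End Constructions.


(** * The widths of the levels and the radio number *)

Section Widths.
Variables (h z : nat) (d : nat -> nat).
Hypotheses (d_ge3 : forall i, i < h -> 3 <= d i) (z12 : z = 1 \/ z = 2).

(** The widths at least double from level to level, whereas the bound grows by
    two; equality is possible on level_list 0 and 1 only. *)
Lemma width_lower l : l <= h ->
  z + 2 * l + (1 < l) <= level_width z (branching z d) l.
Proof.
elim: l => [|l IH] lh; first by rewrite /level_width big_ord0 muln1 !addn0.
have := IH (ltnW lh); have := d_ge3 lh; rewrite widthS /branching.
case: l {IH lh} => [|l]; last by case: z12 => -> /=; nia.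
by rewrite /level_width big_ord0 muln1; case: z12 => -> /=; lia.
Qed.

Lemma width_wide l : l <= h -> z + 2 * l <= level_width z (branching z d) l.
Proof. by move/width_lower; apply: leq_trans; apply: leq_addr. Qed.

Lemma width_wider l : 2 <= l <= h -> z + 2 * l < level_width z (branching z d) l.
Proof. by move=> /andP[l2 /width_lower]; rewrite l2 addn1. Qed.

End Widths.

Theorem theorem4p1 (h n z : nat) (d : nat -> nat) (T : sgraph)
    (h_ge1 : 1 <= h) (n_ge3 : 3 <= n)
    (d_ge3 : forall i : nat, i < h -> 3 <= d i)
    (z12 : z = 1 \/ z = 2)
    (Treg : levelwise_regular_tree T z h d) :
  (z = 1 ->
    rn (box T (complete_graph n)) =
      ((\sum_(1 <= i < h)
          (2 * h - 2 * i - 1) * (\prod_(1 <= j < i.+1) (d j - 1)))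
        + 2 * h - 1) * (n * d 0) + (2 * h + 1) * (n - 1)) /\
  (z = 2 ->
    rn (box T (complete_graph n)) =
      ((\sum_(0 <= i < h)
          (2 * h - 2 * i - 1) * (\prod_(0 <= j < i.+1) (d j - 1)))
        + 2 * h + 1) * (2 * n) - 2 * h - 1).
Proof.
have rT := regular_rooted z12 Treg.
have z_gt0 : 0 < z by case: z12 => ->.
have z_le2 : z <= 2 by case: z12 => ->.
have [x0 _] : exists x0 : T, true.
  by case: Treg => -[/card_gt0P[x0 _] _ _] _ _ _ _; exists x0.
have wide := width_wide d_ge3 z12; have wider := width_wider d_ge3 z12.
have rnE : rn (box T (complete_graph n)) =
    n * (\sum_(0 <= l < h.+1) level_width z (branching z d) l * (2 * h + 1 - 2 * l)) - (2 * h + 1).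
  rewrite -(sum_over_levels x0 rT (fun l => 2 * h + 1 - 2 * l)).
  case: z12 => zE.
    exact: (rn_one_root n_ge3 x0 rT z_le2 z_gt0 h_ge1 wide wider zE).
  exact: (rn_two_roots n_ge3 x0 rT z_le2 z_gt0 h_ge1 wide wider zE).
split=> zE; rewrite {}rnE zE big_nat_recl // {1}/level_width big_ord0 muln0 subn0.
- have wE i : level_width 1 (branching 1 d) i.+1 = d 0 * \prod_(1 <= j < i.+1) (d j - 1).
    rewrite /level_width mul1n big_ord_recl {1}/branching subn0; congr (_ * _).
    by rewrite big_add1 big_mkord; apply: eq_bigr => j _.
  rewrite (big_ltn h_ge1) wE big_geq // muln1.
  have -> : \sum_(1 <= i < h) level_width 1 (branching 1 d) i.+1 * (2 * h + 1 - 2 * i.+1) =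
      d 0 * \sum_(1 <= i < h) (2 * h - 2 * i - 1) * \prod_(1 <= j < i.+1) (d j - 1).
    rewrite big_distrr /=; apply: eq_big_nat => i hi.
    by rewrite wE -mulnA (mulnC (\prod_(_ <= _ < _) _)); congr (_ * (_ * _)); lia.
  move: (\sum_(1 <= i < h) _) => S.
  by case: (h) h_ge1 => // h' _; nia.
- have wE i : level_width 2 (branching 2 d) i.+1 = 2 * \prod_(0 <= j < i.+1) (d j - 1).
    rewrite /level_width big_mkord; congr (_ * _); apply: eq_bigr => j _.
    by rewrite /branching orbT.
  have -> : \sum_(0 <= i < h) level_width 2 (branching 2 d) i.+1 * (2 * h + 1 - 2 * i.+1) =
      2 * \sum_(0 <= i < h) (2 * h - 2 * i - 1) * \prod_(0 <= j < i.+1) (d j - 1).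
    rewrite big_distrr /=; apply: eq_big_nat => i hi.
    by rewrite wE -mulnA (mulnC (\prod_(_ <= _ < _) _)); congr (_ * (_ * _)); lia.
  move: (\sum_(0 <= i < h) _) => S.
  by rewrite muln1 -subnDA; congr (_ - _); nia.
Qed.
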